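(* Let $(A,\Gamma)$ be a graded Hopf algebroid with $\Gamma$ flat over $A$, and let $M$ be a graded $\Gamma$-comodule. (1) If $M$ is relative cotorsion, then $M$ is cotorsion. The converse is true if $A$ is a field. (2) The following conditions on $M$ are equivalent: $V(M)\cong0$; $M$ is relative cotorsion; $Itr(M)\cong0$. (3) If $\Gamma$ is projective over $A$, then $R^nV(M)\cong R^n_{rel}V(M)$ for all $n$.
   Context: Comodules are graded left $\Gamma$-comodules. $V:\mathrm{gr\,Comod}(\Gamma)\to\mathrm{gr\,Mod}(A)$ is the right adjoint of the extended comodule functor $E(N)=\Gamma\otimes_AN$. The standard allowable class on $\mathrm{gr\,Comod}(\Gamma)$ consists of the short exact sequences of graded comodules whose underlying sequences of graded $A$-modules split. A relative monomorphism (epimorphism) is a map occurring as the monomorphism (epimorphism) in a short exact sequence of this class. A comodule $J$ is relatively injective if every map from the domain of a relative monomorphism to $J$ extends to the codomain; the relatively injective comodules are exactly the direct summands of extended comodules $\Gamma\otimes_AN$. A relative injective resolution of $M$ is a resolution by relatively injective comodules whose differentials each factor as a relative epimorphism followed by a relative monomorphism. $Itr(M)$, the relatively injective trace of $M$, is the sum in $M$ of the images of all maps to $M$ from relatively injective comodules. $M$ is relative cotorsion if $Itr(M)=0$, i.e. if there are no nonzero maps from a relatively injective comodule to $M$. $M$ is cotorsion if there are no nonzero maps from an injective object of $\mathrm{gr\,Comod}(\Gamma)$ to $M$. $R^nV$ is the usual $n$th right derived functor of $V$ (using injective resolutions); $R^n_{rel}V(M)$ is the $n$th cohomology of $V$ applied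 to a relative injective resolution of $M$. *)

(* Defs.v *)
From HB Require Import structures.
From mathcomp Require Import all_boot all_order all_algebra.
From mathcomp Require Import boolp.

Set Implicit Arguments.
Unset Strict Implicit.
Unset Printing Implicit Defensive.

Import GRing.Theory.
Local Open Scope ring_scope.
Local Open Scope quotient_scope.

(* Graded objects are families of abelian groups indexed by [int].  An
   operation adding degrees takes the target degree together with a proof that
   it is the sum, so that no transport along equalities of degrees is needed. *)

(* The Koszul sign (-1)^(ij). *)
Definition koszul (i j : int) : int := (-1) ^+ (absz i * absz j)%N.

(* Rings are Z-graded and graded-commutative; the zero ring is allowed. *)
Record grRing := GrRing {
  rcar :> int -> zmodType;
  rone : rcar 0;
  rmul : forall i j k : int, i + j = k -> rcar i -> rcar j -> rcar k;
  rmulDl : forall i j k (e : i + j = k) x y z,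
    rmul e (x + y) z = rmul e x z + rmul e y z;
  rmulDr : forall i j k (e : i + j = k) x y z,
    rmul e x (y + z) = rmul e x y + rmul e x z;
  rmulA : forall i j k ij jk n (e1 : i + j = ij) (e2 : ij + k = n)
                 (e3 : j + k = jk) (e4 : i + jk = n) x y z,
    rmul e2 (rmul e1 x y) z = rmul e4 x (rmul e3 y z);
  rmul1l : forall i (e : 0 + i = i) x, rmul e rone x = x;
  rmul1r : forall i (e : i + 0 = i) x, rmul e x rone = x;
  rmulC : forall i j k (e : i + j = k) (e' : j + i = k) x y,
    rmul e x y = rmul e' y x *~ koszul i j
}.

Record grRingHom (A B : grRing) := GrRingHom {
  rhom :> forall n, A n -> B n;
  rhomD : forall n x y, rhom (x + y) = rhom x + rhom y :> B n;
  rhomM : forall i j k (e : i + j = k) x y,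
    rhom (rmul e x y) = rmul e (rhom x) (rhom y);
  rhom1 : rhom (rone A) = rone B
}.

(* If x is homogeneous and nonzero of nonzero degree, then 1 + x is nonzero and
   not invertible; so a graded ring whose underlying ring is a field is
   concentrated in degree 0. *)
Definition is_field (A : grRing) :=
  [/\ forall n (x : A n), n <> 0 -> x = 0,
      rone A <> 0
    & forall (e : 0 + 0 = 0 :> int) (x : A 0), x <> 0 ->
        exists y : A 0, rmul e x y = rone A].

Record grMod (A : grRing) := GrMod {
  mcar :> int -> zmodType;
  act : forall i j k : int, i + j = k -> A i -> mcar j -> mcar k;
  actDl : forall i j k (e : i + j = k) a b x,
    act e (a + b) x = act e a x + act e b x;
  actDr : forall i j k (e : i + j = k) a x y,
    act e a (x + y) = act e a x + act e a y;
  actA : forall i j k ij jk n (e1 : i + j = ij) (e2 : ij + k = n)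
                (e3 : j + k = jk) (e4 : i + jk = n) a b x,
    act e2 (rmul e1 a b) x = act e4 a (act e3 b x);
  act1 : forall i (e : 0 + i = i) x, act e (rone A) x = x
}.

Record grHom (A : grRing) (X Y : grMod A) := GrHom {
  hfun :> forall n, X n -> Y n;
  hfunD : forall n x y, hfun (x + y) = hfun x + hfun y :> Y n;
  hfun_act : forall i j k (e : i + j = k) (a : A i) (x : X j),
    hfun (act e a x) = act e a (hfun x)
}.

Lemma additive_zmod (U V : zmodType) (f : U -> V) :
  (forall x y, f (x + y) = f x + f y) -> zmod_morphism f.
Proof. by move=> fD x y; apply/eqP; rewrite eq_sym subr_eq -fD subrK. Qed.

HB.instance Definition _ (A B : grRing) (f : grRingHom A B) n :=
  GRing.isZmodMorphism.Build (A n) (B n) (@rhom A B f n)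
    (additive_zmod (@rhomD A B f n)).
HB.instance Definition _ (A : grRing) (X Y : grMod A) (f : grHom X Y) n :=
  GRing.isZmodMorphism.Build (X n) (Y n) (@hfun A X Y f n)
    (additive_zmod (@hfunD A X Y f n)).
HB.instance Definition _ (A : grRing) (X : grMod A) i j k (e : i + j = k) a :=
  GRing.isZmodMorphism.Build (X j) (X k) (act e a)
    (additive_zmod (@actDr A X i j k e a)).
HB.instance Definition _ (A : grRing) i j k (e : i + j = k) (a : A i) :=
  GRing.isZmodMorphism.Build (A j) (A k) (rmul e a)
    (additive_zmod (@rmulDr A i j k e a)).

Lemma grHom_ext (A : grRing) (X Y : grMod A) (f g : grHom X Y) :
  (forall n (x : X n), f n x = g n x) -> f = g.
Proof.
case: f g => [f fD fA] [g gD gA] /= fg.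
have {}fg : f = g by apply: functional_extensionality_dep => n; apply/funext/fg.
by case: _ / fg gD gA => gD gA; congr GrHom; apply: Prop_irrelevance.
Qed.

Section HomOps.
Variable A : grRing.

Definition hid (X : grMod A) : grHom X X :=
  @GrHom A X X (fun n x => x) (fun _ _ _ => erefl) (fun _ _ _ _ _ _ => erefl).

Definition hzero (X Y : grMod A) : grHom X Y.
Proof.
by exists (fun n x => 0) => [n x y|i j k e a x]; rewrite ?addr0 ?raddf0.
Defined.

Definition hcomp (X Y Z : grMod A) (g : grHom Y Z) (f : grHom X Y) : grHom X Z.
Proof.
by exists (fun n x => g n (f n x)) => [n x y|i j k e a x];
  rewrite ?hfunD ?hfun_act.
Defined.

Definition hinj (X Y : grMod A) (f : grHom X Y) :=
  forall n, injective (@hfun A X Y f n).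

Definition hsurj (X Y : grMod A) (f : grHom X Y) :=
  forall n (y : Y n), exists x : X n, f n x = y.

Definition hexact (X Y Z : grMod A) (f : grHom X Y) (g : grHom Y Z) :=
  forall n (y : Y n), g n y = 0 <-> exists x : X n, f n x = y.

Definition grIso (X Y : grMod A) :=
  exists (f : grHom X Y) (g : grHom Y X), hcomp g f = hid X /\ hcomp f g = hid Y.

Definition gr_is_zero (X : grMod A) := forall n (x : X n), x = 0.

Definition gr_projective (P : grMod A) :=
  forall (X Y : grMod A) (p : grHom X Y) (f : grHom P Y),
    hsurj p -> exists g : grHom P X, hcomp p g = f.

End HomOps.

Section Cohomology.
Variable A : grRing.

Record grSub (Y : grMod A) := GrSub {
  smem :> forall n, Y n -> Prop;
  smem0 : forall n, smem (0 : Y n);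
  smemB : forall n (x y : Y n), smem x -> smem y -> smem (x - y);
  smem_act : forall i j k (e : i + j = k) (a : A i) (x : Y j),
    smem x -> smem (act e a x)
}.

Definition spred (Y : grMod A) (S : grSub Y) n : {pred Y n} :=
  fun x => `[< S n x >].
Arguments spred {Y} S n _.

Lemma spredP (Y : grMod A) (S : grSub Y) n (x : Y n) :
  reflect (S n x) (x \in spred S n).
Proof. exact: asboolP. Qed.

Fact spred_closed (Y : grMod A) (S : grSub Y) n : zmod_closed (spred S n).
Proof.
split=> [|x y /spredP Sx /spredP Sy]; apply/spredP; first exact: smem0.
exact: smemB.
Qed.
HB.instance Definition _ (Y : grMod A) (S : grSub Y) n :=
  GRing.isZmodClosed.Build (Y n) (spred S n) (spred_closed S n).

Section Subquotient.
Variables (Y : grMod A) (Z B : grSub Y).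

Definition subpart n := {x : Y n | x \in spred Z n}.
HB.instance Definition _ n := SubChoice.on (subpart n).
HB.instance Definition _ n := [SubChoice_isSubZmodule of subpart n by <:].

Definition subpart_pred n : {pred subpart n} := fun u => val u \in spred B n.
Fact subpart_closed n : zmod_closed (@subpart_pred n).
Proof.
have memE (u : subpart n) : (u \in @subpart_pred n) = (val u \in spred B n) by [].
split=> [|u v]; rewrite !memE; first by rewrite raddf0 rpred0.
by move=> uB vB; rewrite raddfB rpredB.
Qed.
HB.instance Definition _ n :=
  GRing.isZmodClosed.Build (subpart n) (@subpart_pred n) (@subpart_closed n).

Definition sqcar n : zmodType := Quotient.quot (@subpart_pred n).
Definition sqpi n (u : subpart n) : sqcar n :=
  \pi_(Quotient.quot (@subpart_pred n)) u.
Definition sqrepr n (u : sqcar n) : subpart n :=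
  @repr _ (Quotient.quot (@subpart_pred n)) u.

Lemma sqreprK n (u : sqcar n) : sqpi (sqrepr u) = u.
Proof. exact: reprK. Qed.

Lemma sqpi_eqP n (u v : subpart n) :
  sqpi u = sqpi v <-> B n (val u - val v).
Proof.
rewrite -raddfB; split=> [/eqP|]; last move=> Buv; last apply/eqP.
  by rewrite [_ == _]piE Quotient.equivE => /spredP.
by rewrite [_ == _]piE Quotient.equivE; apply/spredP.
Qed.

Lemma sqpiD n (u v : subpart n) : sqpi (u + v) = sqpi u + sqpi v.
Proof. exact: (Quotient.pi_add (@subpart_pred n)). Qed.

Definition subpart_act i j k (e : i + j = k) (a : A i) (u : subpart j) :
    subpart k :=
  exist _ (act e a (val u))
    (introT (spredP Z _) (smem_act e a (elimT (spredP Z _) (valP u)))).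

Definition sqact i j k (e : i + j = k) (a : A i) (u : sqcar j) : sqcar k :=
  sqpi (subpart_act e a (sqrepr u)).

Lemma sqact_pi i j k (e : i + j = k) (a : A i) (u : subpart j) :
  sqact e a (sqpi u) = sqpi (subpart_act e a u).
Proof.
apply/sqpi_eqP; rewrite /= -raddfB; apply: smem_act.
by apply/sqpi_eqP; rewrite sqreprK.
Qed.

Definition subquot : grMod A.
Proof.
exists sqcar sqact.
- move=> i j k e a b u; rewrite -[u]sqreprK !sqact_pi -sqpiD.
  by congr sqpi; apply: val_inj; rewrite raddfD /= actDl.
- move=> i j k e a u v; rewrite -[u]sqreprK -[v]sqreprK -sqpiD !sqact_pi.
  by rewrite -sqpiD; congr sqpi; apply: val_inj; rewrite !raddfD /= raddfD.
- move=> i j k ij jk n e1 e2 e3 e4 a b u; rewrite -[u]sqreprK !sqact_pi.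
  by congr sqpi; apply: val_inj; apply: actA.
- move=> i e u; rewrite -[u]sqreprK !sqact_pi.
  by congr sqpi; apply: val_inj; rewrite /= act1.
Defined.

End Subquotient.

Definition zeroSub (Y : grMod A) : grSub Y.
Proof.
exists (fun n x => x = 0) => // [n x y -> ->|i j k e a x ->].
  by rewrite subr0.
by rewrite raddf0.
Defined.

Definition kerSub (Y Z : grMod A) (g : grHom Y Z) : grSub Y.
Proof.
exists (fun n x => g n x = 0) => [n|n x y gx gy|i j k e a x gx].
- exact: raddf0.
- by rewrite raddfB /= gx gy subr0.
- by rewrite hfun_act gx raddf0.
Defined.

Definition imSub (X Y : grMod A) (f : grHom X Y) : grSub Y.
Proof.
exists (fun n y => exists x, f n x = y).
- by move=> n; exists 0; rewrite raddf0.
- by move=> n _ _ [x <-] [y <-]; exists (x - y); rewrite raddfB.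
- by move=> i j k e a _ [x <-]; exists (act e a x); rewrite hfun_act.
Defined.

Record cochain := Cochain {
  cobj :> nat -> grMod A;
  cdif : forall k, grHom (cobj k) (cobj k.+1);
  cdif2 : forall k, hcomp (cdif k.+1) (cdif k) = hzero (cobj k) (cobj k.+2)
}.

Definition cocycles (C : cochain) k : grSub (C k) := kerSub (cdif C k).

Definition coboundaries (C : cochain) k : grSub (C k) :=
  match k with
  | 0 => zeroSub (C 0)
  | k'.+1 => imSub (cdif C k')
  end.

Definition cohomology (C : cochain) k : grMod A :=
  subquot (cocycles C k) (coboundaries C k).

End Cohomology.

Lemma rmulNl (A : grRing) i j k (e : i + j = k) (x : A i) (y : A j) :
  rmul e (- x) y = - rmul e x y.
Proof.
have z : rmul e 0 y = 0.
  by apply: (@addIr _ (rmul e 0 y)); rewrite -rmulDl addr0 add0r.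
by apply/eqP; rewrite -subr_eq0 opprK -rmulDl addNr z.
Qed.

(* The part (A, Gamma, eta_L, eta_R) of the structure of a Hopf algebroid that
   makes Gamma an A-bimodule, [a . g . b = etaL a * g * etaR b]. *)
Record unitPair := UnitPair {
  uA : grRing;
  uG : grRing;
  etaL : grRingHom uA uG;
  etaR : grRingHom uA uG
}.

Section Tensor.
Variables (H : unitPair) (N : grMod (uA H)).
Local Notation A := (uA H).
Local Notation G := (uG H).

(* The degree n part of the tensor product over A of Gamma (a right module
   through eta_R) with N: finite lists of homogeneous pure tensors of total
   degree n, standing for their sums, modulo the relations [teq]; no formal
   opposites are needed because [- (g ⊗ x) = (- g) ⊗ x]. *)
Record tgen (n : int) := TGen {
  tdl : int;
  tdr : int;
  tdeg : tdl + tdr = n;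
  tleft : G tdl;
  tright : N tdr
}.

Inductive teq n : seq (tgen n) -> seq (tgen n) -> Prop :=
| teq_refl s : teq s s
| teq_sym s t : teq s t -> teq t s
| teq_trans s t u : teq s t -> teq t u -> teq s u
| teq_cat s s' t t' : teq s s' -> teq t t' -> teq (s ++ t) (s' ++ t')
| teq_comm s t : teq (s ++ t) (t ++ s)
| teq_0 i j (e : i + j = n) (x : N j) : teq [:: TGen e 0 x] [::]
| teq_Dl i j (e : i + j = n) (g h : G i) (x : N j) :
    teq [:: TGen e (g + h) x] [:: TGen e g x; TGen e h x]
| teq_Dr i j (e : i + j = n) (g : G i) (x y : N j) :
    teq [:: TGen e g (x + y)] [:: TGen e g x; TGen e g y]
| teq_bal i j k ij jk (e1 : i + j = ij) (e2 : ij + k = n)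
    (e3 : j + k = jk) (e4 : i + jk = n) (g : G i) (a : A j) (x : N k) :
    teq [:: TGen e2 (rmul e1 g (etaR H j a)) x] [:: TGen e4 g (act e3 a x)].

HB.instance Definition _ n := gen_eqMixin (tgen n).
HB.instance Definition _ n := gen_choiceMixin (tgen n).

Definition teqb n (s t : seq (tgen n)) : bool := `[< teq s t >].

Fact teqb_equiv n : equiv_class_of (@teqb n).
Proof.
split=> [s|s t|s t u]; first exact/asboolP/teq_refl.
  by apply/idP/idP=> /asboolP st; apply/asboolP/teq_sym.
by move=> /asboolP st /asboolP tu; apply/asboolP; apply: teq_trans st tu.
Qed.
Canonical teqb_equiv_rel n := EquivRelPack (@teqb_equiv n).
Canonical teqb_encModRel n := defaultEncModRel (@teqb n).

Definition tcar n := {eq_quot @teqb n}.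
HB.instance Definition _ n := Choice.on (tcar n).

Definition tpi n (s : seq (tgen n)) : tcar n := \pi_({eq_quot @teqb n}) s.
Definition trepr n (t : tcar n) : seq (tgen n) := @repr _ {eq_quot @teqb n} t.

Lemma treprK n (t : tcar n) : tpi (trepr t) = t.
Proof. exact: reprK. Qed.

Lemma tpi_eqP n (s t : seq (tgen n)) : tpi s = tpi t <-> teq s t.
Proof.
split=> [/eqP|st]; last apply/eqP.
  by rewrite [_ == _]piE => /asboolP.
by rewrite [_ == _]piE; apply/asboolP.
Qed.

Definition tgen_opp n (g : tgen n) := TGen (tdeg g) (- tleft g) (tright g).

Lemma teq_opp n (s t : seq (tgen n)) :
  teq s t -> teq (map (@tgen_opp n) s) (map (@tgen_opp n) t).
Proof.
elim=> {s t}.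
- by move=> s; apply: teq_refl.
- by move=> s t _; apply: teq_sym.
- by move=> s t u _ st _; apply: teq_trans.
- by move=> s s' t t' _ ss' _ tt'; rewrite !map_cat; apply: teq_cat.
- by move=> s t; rewrite !map_cat; apply: teq_comm.
- by move=> i j e x; rewrite /= /tgen_opp /= oppr0; apply: teq_0.
- by move=> i j e g h x; rewrite /= /tgen_opp /= opprD; apply: teq_Dl.
- by move=> i j e g x y; apply: teq_Dr.
- move=> i j k ij jk e1 e2 e3 e4 g a x; rewrite /= /tgen_opp /=.
  by rewrite -rmulNl; apply: teq_bal.
Qed.

Lemma teq_oppK n (s : seq (tgen n)) : teq (map (@tgen_opp n) s ++ s) [::].
Proof.
elim: s => [|[i j e g x] s IHs] /=; first exact: teq_refl.
have gx0 : teq [:: TGen e (- g) x; TGen e g x] [::].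
  apply: teq_trans (teq_0 e x); apply: teq_sym.
  by rewrite -{1}(addNr g); apply: teq_Dl.
have := teq_cat gx0 IHs; apply: teq_trans.
set p := TGen e g x; set m := map _ s.
apply: (@teq_cat n [:: _] [:: _] (m ++ [:: p] ++ s) ([:: p] ++ m ++ s)).
  exact: teq_refl.
by rewrite !catA; apply: teq_cat; [apply: teq_comm | apply: teq_refl].
Qed.

Definition tzero n : tcar n := tpi [::].
Definition tadd n (t u : tcar n) : tcar n := tpi (trepr t ++ trepr u).
Definition topp n (t : tcar n) : tcar n := tpi (map (@tgen_opp n) (trepr t)).

Lemma tadd_pi n (s t : seq (tgen n)) : tadd (tpi s) (tpi t) = tpi (s ++ t).
Proof. by apply/tpi_eqP; apply: teq_cat; apply/tpi_eqP; rewrite treprK. Qed.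

Lemma topp_pi n (s : seq (tgen n)) : topp (tpi s) = tpi (map (@tgen_opp n) s).
Proof. by apply/tpi_eqP; apply: teq_opp; apply/tpi_eqP; rewrite treprK. Qed.

Fact taddA n : associative (@tadd n).
Proof.
move=> t u v; rewrite -[t]treprK -[u]treprK -[v]treprK !tadd_pi.
by rewrite catA.
Qed.
Fact taddC n : commutative (@tadd n).
Proof.
move=> t u; rewrite -[t]treprK -[u]treprK !tadd_pi.
by apply/tpi_eqP; apply: teq_comm.
Qed.
Fact tadd0 n : left_id (@tzero n) (@tadd n).
Proof. by move=> t; rewrite -[t]treprK tadd_pi. Qed.
Fact taddN n : left_inverse (@tzero n) (@topp n) (@tadd n).
Proof.
move=> t; rewrite -[t]treprK topp_pi tadd_pi.
by apply/tpi_eqP; apply: teq_oppK.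
Qed.
HB.instance Definition _ n :=
  GRing.isZmodule.Build (tcar n) (@taddA n) (@taddC n) (@tadd0 n) (@taddN n).

Definition tpure n i j (e : i + j = n) (g : G i) (x : N j) : tcar n :=
  tpi [:: TGen e g x].

Lemma tpiE n (s : seq (tgen n)) :
  tpi s = \sum_(p <- s) tpure (tdeg p) (tleft p) (tright p).
Proof.
elim: s => [|[i j e g x] s IHs]; first by rewrite big_nil.
by rewrite big_cons -IHs -cat1s [RHS]tadd_pi.
Qed.

Section Lift.
Variables (B : zmodType) (n : int).
Variable f : forall i j, i + j = n -> G i -> N j -> B.

(* The additive map [g ⊗ x |-> f g x]; meaningful for balanced [f] only. *)
Definition tlift (t : tcar n) : B :=
  \sum_(p <- trepr t) f (tdeg p) (tleft p) (tright p).

Record balanced : Prop := Balanced {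
  balDl : forall i j (e : i + j = n) g h x, f e (g + h) x = f e g x + f e h x;
  balDr : forall i j (e : i + j = n) g x y, f e g (x + y) = f e g x + f e g y;
  balA : forall i j k ij jk (e1 : i + j = ij) (e2 : ij + k = n)
      (e3 : j + k = jk) (e4 : i + jk = n) (g : G i) (a : A j) (x : N k),
    f e2 (rmul e1 g (etaR H j a)) x = f e4 g (act e3 a x)
}.

Hypothesis fB : balanced.

Lemma tlift_teq (s t : seq (tgen n)) : teq s t ->
  \sum_(p <- s) f (tdeg p) (tleft p) (tright p) =
  \sum_(p <- t) f (tdeg p) (tleft p) (tright p).
Proof.
elim=> {s t} //.
- by move=> s t u _ -> _ ->.
- by move=> s s' t t' _ ss' _ tt'; rewrite !big_cat /= ss' tt'.
- by move=> s t; rewrite !big_cat /= addrC.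
- move=> i j e x; rewrite big_seq1 big_nil /=.
  by apply: (@addIr _ (f e 0 x)); rewrite -balDl // addr0 add0r.
- by move=> i j e g h x; rewrite !big_cons !big_nil !addr0 /= balDl.
- by move=> i j e g x y; rewrite !big_cons !big_nil !addr0 /= balDr.
- by move=> i j k ij jk e1 e2 e3 e4 g a x; rewrite !big_seq1 /=; apply: balA.
Qed.

Lemma tlift_pi s :
  tlift (tpi s) = \sum_(p <- s) f (tdeg p) (tleft p) (tright p).
Proof. by apply: tlift_teq; apply/tpi_eqP; rewrite treprK. Qed.

Lemma tlift_pure i j (e : i + j = n) g x : tlift (tpure e g x) = f e g x.
Proof. by rewrite tlift_pi big_seq1. Qed.

Lemma tliftD t u : tlift (t + u) = tlift t + tlift u.
Proof.
by rewrite -[t]treprK -[u]treprK [_ + _]tadd_pi !tlift_pi big_cat.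
Qed.

End Lift.

Lemma tpure_bal n : balanced (@tpure n).
Proof.
split=> [i j e g h x|i j e g x y|i j k ij jk e1 e2 e3 e4 g a x].
- by rewrite [RHS]tadd_pi; apply/tpi_eqP; apply: teq_Dl.
- by rewrite [RHS]tadd_pi; apply/tpi_eqP; apply: teq_Dr.
- by apply/tpi_eqP; apply: teq_bal.
Qed.

Lemma tens_ind n (P : tcar n -> Prop) :
  P 0 -> (forall t u, P t -> P u -> P (t + u)) ->
  (forall i j (e : i + j = n) g x, P (tpure e g x)) -> forall t, P t.
Proof.
move=> P0 PD Pp t; rewrite -[t]treprK tpiE.
by elim/big_ind: _ => // p _; apply: Pp.
Qed.

Lemma tens_ext n (B : zmodType) (f g : tcar n -> B) :
  (forall t u, f (t + u) = f t + f u) -> (forall t u, g (t + u) = g t + g u) ->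
  (forall i j (e : i + j = n) a x, f (tpure e a x) = g (tpure e a x)) ->
  forall t, f t = g t.
Proof.
move=> fD gD fg; apply: tens_ind => // [|t u ft gu]; last by rewrite fD gD ft gu.
have z0 (h : tcar n -> B) : (forall t u, h (t + u) = h t + h u) -> h 0 = 0.
  by move=> hD; apply: (@addIr _ (h 0)); rewrite -hD addr0 add0r.
by rewrite !z0.
Qed.

End Tensor.

Section DegreeArithmetic.
Variables (m n i j k : int).

Fact deg_addl : m + n = k -> i + j = n -> m + i + j = k.
Proof. by move=> <- <-; rewrite addrA. Qed.

Fact deg_addr : n + m = k -> i + j = n -> i + (j + m) = k.
Proof. by move=> <- <-; rewrite addrA. Qed.

Fact deg_swap p q : m + n = k -> i + j = m -> p + q = n ->
  i + p + (j + q) = k.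
Proof. by move=> <- <- <-; rewrite addrACA. Qed.

End DegreeArithmetic.

(* Gamma as a left A-module through eta_L. *)
Definition leftGamma (H : unitPair) : grMod (uA H).
Proof.
exists (uG H) (fun i j k e a g => rmul e (etaL H i a) g).
- by move=> i j k e a b x; rewrite rhomD rmulDl.
- by move=> i j k e a x y; rewrite rmulDr.
- by move=> i j k ij jk n e1 e2 e3 e4 a b x; rewrite rhomM; apply: rmulA.
- by move=> i e x; rewrite rhom1 rmul1l.
Defined.

Section Extended.
Variable H : unitPair.
Local Notation A := (uA H).
Local Notation G := (uG H).

Section Object.
Variable N : grMod A.

Definition tact i j k (e : i + j = k) (a : A i) (t : tcar N j) : tcar N k :=
  tlift (fun p q (e' : p + q = j) (g : G p) (x : N q) =>
    tpure (deg_addl e e') (rmul erefl (etaL H i a) g) x) t.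

Lemma tact_bal i j k (e : i + j = k) (a : A i) :
  balanced (fun p q (e' : p + q = j) (g : G p) (x : N q) =>
    tpure (deg_addl e e') (rmul erefl (etaL H i a) g) x).
Proof.
split=> [p q e' g h x|p q e' g x y|p q r pq qr e1 e2 e3 e4 g b x].
- by rewrite rmulDr (balDl (tpure_bal N k)).
- by rewrite (balDr (tpure_bal N k)).
- have E : i + p + q = i + pq by rewrite -addrA e1.
  rewrite -(rmulA erefl E e1 erefl); exact: (balA (tpure_bal N k)).
Qed.

Lemma tpure_mul k i p q r r' (e : i + p = r) (e' : i + p = r')
    (f : r + q = k) (f' : r' + q = k) (a : G i) g (x : N q) :
  tpure f (rmul e a g) x = tpure f' (rmul e' a g) x.
Proof.
by subst r r'; rewrite (Prop_irrelevance f f').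
Qed.

Lemma tact_pure i j k (e : i + j = k) a p q r (e' : p + q = j)
    (e1 : i + p = r) (e2 : r + q = k) g (x : N q) :
  tact e a (tpure e' g x) = tpure e2 (rmul e1 (etaL H i a) g) x.
Proof. rewrite [LHS]tlift_pure; [exact: tpure_mul | exact: tact_bal]. Qed.

Lemma tactDr i j k (e : i + j = k) a (t u : tcar N j) :
  tact e a (t + u) = tact e a t + tact e a u.
Proof. exact/tliftD/tact_bal. Qed.

(* Gamma ⊗_A N, a left A-module through the left action on Gamma. *)
Definition extMod : grMod A.
Proof.
exists (tcar N) tact.
- move=> i j k e a b; apply: tens_ext => [t u|t u|p q e' g x].
  + exact: tactDr.
  + by rewrite !tactDr addrACA.
  + by rewrite !(tact_pure _ _ _ erefl (deg_addl e e')) rhomD rmulDl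
      (balDl (tpure_bal N k)).
- exact: tactDr.
- move=> i j k ij jk n e1 e2 e3 e4 a b; apply: tens_ext => [t u|t u|p q e' g x].
  + exact: tactDr.
  + by rewrite !tactDr.
  + have E : j + p + q = jk by rewrite -e3 -e' addrA.
    have E' : i + (j + p) + q = n by rewrite -e4 -e3 -e' !addrA.
    have E2 : ij + p = i + (j + p) by rewrite -e1 addrA.
    rewrite (tact_pure _ _ _ erefl E) (tact_pure _ _ _ erefl E').
    rewrite (tact_pure _ _ _ E2 E') rhomM; congr tpure; exact: rmulA.
- move=> i e; apply: tens_ext => [t u|//|p q e' g x].
    exact: tactDr.
  by rewrite (tact_pure _ _ _ (add0r p) e') rhom1 rmul1l.
Defined.

End Object.

(* The additive map [g ⊗ x |-> g ⊗ h x], for [h] of degree d. *)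
Definition shift_map (X Y : grMod A) (d : int) :=
  forall q r : int, q + d = r -> X q -> Y r.

Record shift_linear (X Y : grMod A) d (h : shift_map X Y d) : Prop :=
  ShiftLinear {
    slD : forall q r (e : q + d = r) x y, h q r e (x + y) = h q r e x + h q r e y;
    sl_act : forall i j k r s (e : i + j = k) (e1 : k + d = r) (e2 : j + d = s)
        (e3 : i + s = r) (a : A i) (x : X j),
      h k r e1 (act e a x) = act e3 a (h j s e2 x)
  }.

Definition tmapd (X Y : grMod A) d (h : shift_map X Y d) n m (e : n + d = m)
    (t : extMod X n) : extMod Y m :=
  tlift (fun p q (e' : p + q = n) (g : G p) (x : X q) =>
    tpure (deg_addr e e') g (h q _ erefl x)) t.

Section ShiftMap.
Variables (X Y : grMod A) (d : int) (h : shift_map X Y d).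
Hypothesis hL : shift_linear h.

Lemma tmapd_bal n m (e : n + d = m) :
  balanced (fun p q (e' : p + q = n) (g : G p) (x : X q) =>
    tpure (deg_addr e e') g (h erefl x)).
Proof.
split=> [p q e' g g' x|p q e' g x y|p q r pq qr e1 e2 e3 e4 g b x].
- exact: (balDl (tpure_bal Y m)).
- by rewrite (slD hL) (balDr (tpure_bal Y m)).
- have E : q + (r + d) = qr + d by rewrite addrA e3.
  rewrite (sl_act hL e3 erefl erefl E); exact: (balA (tpure_bal Y m)).
Qed.

Lemma tmapdD n m (e : n + d = m) (t u : extMod X n) :
  tmapd h e (t + u) = tmapd h e t + tmapd h e u.
Proof. exact/tliftD/tmapd_bal. Qed.

Lemma tmapd_pure n m (e : n + d = m) p q r (e' : p + q = n) (e1 : q + d = r)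
    (e2 : p + r = m) g x :
  tmapd h e (tpure e' g x) = tpure e2 g (h e1 x).
Proof.
rewrite [LHS]tlift_pure; last exact: tmapd_bal.
by subst r; congr tpure; apply: Prop_irrelevance.
Qed.

Lemma tmapd_linear : shift_linear (tmapd h).
Proof.
split=> [q r e x y|i j k r s e e1 e2 e3 a]; first exact: tmapdD.
apply: tens_ext => [t u|t u|p q e' g x].
- by rewrite actDr tmapdD.
- by rewrite tmapdD actDr.
- have E : p + (q + d) = s by rewrite addrA e'.
  have E' : i + p + (q + d) = r by rewrite -e3 -E !addrA.
  rewrite [act e a _](tact_pure e a e' erefl (deg_addl e e')).
  by rewrite (tmapd_pure _ _ erefl E') (tmapd_pure _ _ erefl E)
    [RHS](tact_pure _ _ _ erefl E').
Qed.

End ShiftMap.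

Lemma tpure_linear (N : grMod A) j (x : N j) :
  @shift_linear (leftGamma H) (extMod N) j
    (fun q r (e : q + j = r) g => tpure e g x).
Proof.
split=> [q r e g h|i p k r s e e1 e2 e3 a g].
  exact: (balDl (tpure_bal N r)).
by rewrite [RHS](tact_pure _ _ _ e e1).
Qed.

Section Map.
Variables (X Y : grMod A) (f : grHom X Y).

Lemma extMap_bal n :
  balanced (fun i j (e : i + j = n) (g : G i) (x : X j) => tpure e g (f j x)).
Proof.
split=> [i j e g g' x|i j e g x y|i j k ij jk e1 e2 e3 e4 g a x].
- exact: (balDl (tpure_bal Y n)).
- by rewrite hfunD (balDr (tpure_bal Y n)).
- by rewrite (hfun_act f e3); apply: (balA (tpure_bal Y n)).
Qed.

Definition extMap : grHom (extMod X) (extMod Y).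
Proof.
exists (fun n => tlift (fun i j e g x => tpure e g (f j x))) => [n|i j k e a].
  exact/tliftD/extMap_bal.
apply: tens_ext => [t u|t u|p q e' g x].
- by rewrite actDr (tliftD (extMap_bal _)).
- by rewrite (tliftD (extMap_bal _)) actDr.
- rewrite [act e a _](tact_pure e a e' erefl (deg_addl e e')).
  rewrite !(tlift_pure (extMap_bal _)).
  by rewrite [RHS](tact_pure _ _ _ erefl (deg_addl e e')).
Defined.

Lemma extMap_pure n i j (e : i + j = n) g x :
  extMap n (tpure e g x) = tpure e g (f j x).
Proof. exact/tlift_pure/extMap_bal. Qed.

End Map.

End Extended.

Section Structure.
Variable H : unitPair.
Local Notation A := (uA H).
Local Notation G := (uG H).
Local Notation GG := (extMod (leftGamma H)).

(* (a ⊗ b)(c ⊗ d) = (-1)^(|b||c|) ac ⊗ bd on Gamma ⊗_A Gamma. *)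
Definition tmul m n k (e : m + n = k) (t : GG m) (u : GG n) : GG k :=
  tlift (N := leftGamma H) (fun i j (e1 : i + j = m) (a : G i) (b : G j) =>
    tlift (N := leftGamma H) (fun p q (e2 : p + q = n) (c : G p) (d : G q) =>
      tpure (N := leftGamma H) (deg_swap e e1 e2)
        (rmul erefl a c) (rmul erefl b d) *~ koszul j p) u) t.

(* Gamma ⊗_A N -> Gamma ⊗_A (Gamma ⊗_A N), [g ⊗ x |-> sum g' ⊗ (g'' ⊗ x)],
   where [D g = sum g' ⊗ g'']. *)
Definition cofree_coact (D : grHom (leftGamma H) GG) (N : grMod A) n
    (t : extMod N n) : extMod (extMod N) n :=
  tlift (fun i j (e : i + j = n) (g : G i) (x : N j) =>
    tmapd (X := leftGamma H) (Y := extMod N)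
      (fun q r (e' : q + j = r) (b : G q) => tpure e' b x) e (D i g)) t.

(* Gamma ⊗_A N -> N, [g ⊗ x |-> eps g . x]. *)
Definition counit_act (eps : grRingHom G A) (N : grMod A) n
    (t : extMod N n) : N n :=
  tlift (fun i j (e : i + j = n) (g : G i) (x : N j) => act e (eps i g) x) t.

(* Gamma ⊗_A Gamma -> Gamma, [a ⊗ b |-> f a * h b]. *)
Definition tmul_map (f h : forall n, G n -> G n) n (t : GG n) : G n :=
  tlift (N := leftGamma H)
    (fun i j (e : i + j = n) (a : G i) (b : G j) => rmul e (f i a) (h j b)) t.

End Structure.

Record hopfAlgebroid := HopfAlgebroid {
  hunits :> unitPair;
  Delta : grHom (leftGamma hunits) (extMod (leftGamma hunits));
  eps : grRingHom (uG hunits) (uA hunits);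
  conj : grRingHom (uG hunits) (uG hunits);
  eps_etaL : forall n a, eps n (etaL hunits n a) = a;
  eps_etaR : forall n a, eps n (etaR hunits n a) = a;
  Delta_etaR : forall n (a : uA hunits n),
    Delta n (etaR hunits n a) =
    tpure (add0r n) (rone (uG hunits)) (etaR hunits n a : leftGamma hunits n);
  Delta1 : Delta 0 (rone (uG hunits)) =
    tpure (add0r 0) (rone (uG hunits)) (rone (uG hunits) : leftGamma hunits 0);
  DeltaM : forall i j k (e : i + j = k) (g : uG hunits i) (h : uG hunits j),
    Delta k (rmul e g h) = tmul e (Delta i g) (Delta j h);
  Delta_coassoc : forall n (g : uG hunits n),
    extMap Delta n (Delta n g) = cofree_coact Delta (Delta n g);
  Delta_counitl : forall n (g : uG hunits n),
    counit_act eps (Delta n g) = g;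
  Delta_counitr : forall n (g : uG hunits n),
    tmul_map (fun _ a => a) (fun i b => etaR hunits i (eps i b)) (Delta n g) = g;
  conjK : forall n (g : uG hunits n), conj n (conj n g) = g;
  conj_etaL : forall n a, conj n (etaL hunits n a) = etaR hunits n a;
  conj_etaR : forall n a, conj n (etaR hunits n a) = etaL hunits n a;
  conj_mull : forall n (g : uG hunits n),
    tmul_map conj (fun _ b => b) (Delta n g) = etaR hunits n (eps n g);
  conj_mulr : forall n (g : uG hunits n),
    tmul_map (fun _ a => a) conj (Delta n g) = etaL hunits n (eps n g)
}.


Lemma koszulDr i j k : koszul i (j + k) = koszul i j * koszul i k.
Proof.
have odd_subn (m n : nat) : odd (absz (m%:Z - n%:Z)) = odd m (+) odd n.
  case: (leqP n m) => [nm|/ltnW mn]; first by rewrite subzn //= oddB.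
  by rewrite -opprB abszN subzn //= oddB // addbC.
have odd_absD (a b : int) : odd (absz (a + b)) = odd (absz a) (+) odd (absz b).
  case: a b => [a|a] [b|b].
  - by rewrite -PoszD /= oddD.
  - by rewrite [Negz b]NegzE odd_subn abszN.
  - by rewrite [Negz a]NegzE addrC odd_subn abszN addbC.
  - by rewrite !NegzE -opprD -PoszD !abszN oddD.
rewrite /koszul -exprD -mulnDr -signr_odd -[RHS]signr_odd; congr (_ ^+ _).
by rewrite !oddM oddD odd_absD.
Qed.

Lemma koszulC i j : koszul i j = koszul j i.
Proof. by rewrite /koszul mulnC. Qed.

Lemma koszul0 i : koszul i 0 = 1.
Proof. by rewrite /koszul muln0. Qed.

Section Balanced.
Variable H : hopfAlgebroid.
Local Notation A := (uA H).
Local Notation G := (uG H).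
Local Notation GG := (extMod (leftGamma H)).

Lemma counit_act_bal (N : grMod A) n : balanced
  (fun i j (e : i + j = n) (g : G i) (x : N j) => act e (eps H i g) x).
Proof.
split=> [i j e g h x|i j e g x y|i j k ij jk e1 e2 e3 e4 g a x].
- by rewrite rhomD actDl.
- by rewrite actDr.
- by rewrite rhomM eps_etaR; apply: actA.
Qed.

Lemma counit_act_pure (N : grMod A) n i j (e : i + j = n) g (x : N j) :
  counit_act (eps H) (tpure e g x) = act e (eps H i g) x.
Proof. exact/tlift_pure/counit_act_bal. Qed.

Section TmulMap.
Variable n : int.

Let tmul_map_fun (f h : forall n, G n -> G n) :=
  fun i j (e : i + j = n) (a : G i) (b : leftGamma H j) => rmul e (f i a) (h j b).

Lemma counitr_bal :
  balanced (tmul_map_fun (fun _ a => a) (fun i b => etaR H i (eps H i b))).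
Proof.
split=> [i j e g g' x|i j e g x y|i j k ij jk e1 e2 e3 e4 g a x].
- exact: rmulDl.
- by rewrite /tmul_map_fun !rhomD rmulDr.
- rewrite /tmul_map_fun rhomM eps_etaL rhomM; exact: rmulA.
Qed.

Lemma conj_mull_bal : balanced (tmul_map_fun (conj H) (fun _ b => b)).
Proof.
split=> [i j e g g' x|i j e g x y|i j k ij jk e1 e2 e3 e4 g a x].
- by rewrite /tmul_map_fun rhomD rmulDl.
- exact: rmulDr.
- by rewrite /tmul_map_fun rhomM conj_etaR; apply: rmulA.
Qed.

Lemma conj_mulr_bal : balanced (tmul_map_fun (fun _ a => a) (conj H)).
Proof.
split=> [i j e g g' x|i j e g x y|i j k ij jk e1 e2 e3 e4 g a x].
- exact: rmulDl.
- by rewrite /tmul_map_fun rhomD rmulDr.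
- by rewrite /tmul_map_fun rhomM conj_etaL; apply: rmulA.
Qed.

End TmulMap.

Lemma tpureMz (N : grMod A) n i j (e : i + j = n) (g : G i) (x : N j) z :
  tpure e (g *~ z) x = tpure e g x *~ z.
Proof.
pose f (g : G i) := tpure e g x.
have fD : zmod_morphism f.
  by apply: additive_zmod => a b; apply: (balDl (tpure_bal N n)).
pose F : {additive G i -> tcar N n} :=
  HB.pack f (GRing.isZmodMorphism.Build _ _ f fD).
exact: (raddfMz F).
Qed.

Lemma tpureMzr (N : grMod A) n i j (e : i + j = n) (g : G i) (x : N j) z :
  tpure e g (x *~ z) = tpure e g x *~ z.
Proof.
pose f (x : N j) := tpure e g x.
have fD : zmod_morphism f.
  by apply: additive_zmod => a b; apply: (balDr (tpure_bal N n)).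
pose F : {additive N j -> tcar N n} :=
  HB.pack f (GRing.isZmodMorphism.Build _ _ f fD).
exact: (raddfMz F).
Qed.

Lemma rmulMzl i j k (e : i + j = k) (a : G i) (b : G j) z :
  rmul e (a *~ z) b = rmul e a b *~ z.
Proof.
pose f (a : G i) := rmul e a b.
have fD : zmod_morphism f by apply: additive_zmod => x y; apply: rmulDl.
pose F : {additive G i -> G k} :=
  HB.pack f (GRing.isZmodMorphism.Build _ _ f fD).
exact: (raddfMz F).
Qed.

Lemma rmulMzr i j k (e : i + j = k) (a : G i) (b : G j) z :
  rmul e a (b *~ z) = rmul e a b *~ z.
Proof. exact: raddfMz. Qed.

Section Tmul.
Variables (m n k : int) (e : m + n = k).

Definition tmul2 i j (e1 : i + j = m) (a : G i) (b : G j) p q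
    (e2 : p + q = n) (c : G p) (d : leftGamma H q) : GG k :=
  tpure (N := leftGamma H) (deg_swap e e1 e2)
    (rmul erefl a c) (rmul erefl b d) *~ koszul j p.

Lemma tmul2_bal i j (e1 : i + j = m) (a : G i) (b : G j) :
  balanced (tmul2 e1 a b).
Proof.
rewrite /tmul2; split=> [p q e2 c d x|p q e2 c x y|p s q ps sq f1 f2 f3 f4 c a' d].
- by rewrite rmulDr (balDl (tpure_bal _ k)) mulrzDl.
- by rewrite rmulDr (balDr (tpure_bal _ k)) mulrzDl.
- have E1 : i + p + s = i + ps by rewrite -addrA f1.
  have E3 : s + (j + q) = j + sq by rewrite -f3 addrCA.
  rewrite -(rmulA erefl E1 f1 erefl).
  rewrite (balA (tpure_bal (leftGamma H) k) _ _ E3 (deg_swap e e1 f4)).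
  have E4 : j + s + q = j + sq by rewrite -addrA f3.
  have <- : koszul j p * koszul j s = koszul j ps by rewrite -koszulDr f1.
  rewrite mulrzA mulrzAC; congr (_ *~ _); rewrite /= -(rmulA erefl E4 f3 erefl).
  rewrite (rmulC erefl (addrC s j)) rmulMzl -tpureMzr; congr tpure.
  by congr (_ *~ _); apply/esym/rmulA.
Qed.

Lemma tmul_bal (u : GG n) :
  balanced (N := leftGamma H) (fun i j (e1 : i + j = m) (a : G i) (b : G j) =>
    tlift (tmul2 e1 a b) u).
Proof.
split=> [i j e1 a a' b|i j e1 a b b'|i j l ij jl f1 f2 f3 f4 a a' b].
- rewrite -big_split; apply: eq_bigr => v _; rewrite /tmul2 rmulDl /=.
  by rewrite (balDl (tpure_bal _ k)) mulrzDl.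
- rewrite -big_split; apply: eq_bigr => v _; rewrite /tmul2 rmulDl /=.
  by rewrite (balDr (tpure_bal _ k)) mulrzDl.
apply: eq_bigr => -[p q e2 c d] _; rewrite /tmul2 /=.
have E1 : j + (l + q) = jl + q by rewrite addrA f3.
have E2 : i + p + j = ij + p by rewrite addrAC f1.
have E3 : i + (j + p) = ij + p by rewrite addrA f1.
rewrite (rmulA f3 erefl erefl E1).
rewrite -(balA (tpure_bal (leftGamma H) k) E2 (deg_swap e f2 e2) E1).
rewrite (rmulA f1 erefl erefl E3) (rmulC erefl (addrC p j)) rmulMzr tpureMz.
rewrite -(rmulA erefl E2 (addrC p j) E3) koszulC -koszulC -f3.
by rewrite [koszul (j + l) p]koszulC koszulDr mulrzA ![koszul p _]koszulC.
Qed.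

End Tmul.


Lemma etaR_linear j (a : A j) : @shift_linear _ (leftGamma H) (leftGamma H) j
  (fun q r (e : q + j = r) (b : G q) => rmul e b (etaR H j a)).
Proof.
split=> [q r e x y|i l k r s e e1 e2 e3 a' x]; first exact: rmulDl.
exact: rmulA.
Qed.

Lemma Delta_right i j k (e : i + j = k) (g : G i) (a : A j) :
  Delta H k (rmul e g (etaR H j a)) =
  tmapd (X := leftGamma H) (Y := leftGamma H)
    (fun q r (e : q + j = r) (b : G q) => rmul e b (etaR H j a)) e (Delta H i g).
Proof.
rewrite DeltaM Delta_etaR; apply: eq_bigr => -[p q e1 c d] _ /=.
rewrite [LHS](tlift_pure (tmul2_bal e e1 c d)) /tmul2 koszul0 mulr1z.
rewrite (tpure_mul (N := leftGamma H) erefl (addr0 p) _ (deg_addr e e1)).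
by rewrite rmul1r.
Qed.

Section Cofree.
Variable N : grMod A.

Lemma cofree_bal n : balanced (fun i j (e : i + j = n) (g : G i) (x : N j) =>
  tmapd (X := leftGamma H) (Y := extMod N)
    (fun q r (e' : q + j = r) (b : G q) => tpure e' b x) e (Delta H i g)).
Proof.
split=> [i j e g h x|i j e g x y|i j k ij jk e1 e2 e3 e4 g a x].
- by rewrite hfunD (tmapdD (tpure_linear x)).
- rewrite -big_split; apply: eq_bigr => p _ /=.
  by rewrite (balDr (tpure_bal N _)) (balDr (tpure_bal _ _)).
rewrite Delta_right; move: (Delta H i g).
have rx := tpure_linear x; have ra := etaR_linear a.
apply: tens_ext => [t u|t u|p q e g' b].
- by rewrite (tmapdD ra) (tmapdD rx).
- by rewrite (tmapdD (tpure_linear _)).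
have E : p + (q + jk) = n by rewrite addrA e.
have E1 : p + (q + j) = ij by rewrite addrA e.
have E2 : q + j + k = q + jk by rewrite -addrA e3.
rewrite (tmapd_pure ra e1 e erefl E1) (tmapd_pure rx e2 E1 E2 E).
rewrite (tmapd_pure (tpure_linear _) e4 e erefl E); congr tpure.
exact: (balA (tpure_bal N _)).
Qed.

Lemma cofree_pure n i j (e : i + j = n) g (x : N j) :
  cofree_coact (Delta H) (tpure e g x) =
  tmapd (X := leftGamma H) (Y := extMod N)
    (fun q r (e' : q + j = r) (b : G q) => tpure e' b x) e (Delta H i g).
Proof. exact/tlift_pure/cofree_bal. Qed.

Lemma cofreeD n (t u : extMod N n) :
  cofree_coact (Delta H) (t + u) =
  cofree_coact (Delta H) t + cofree_coact (Delta H) u.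
Proof. exact/tliftD/cofree_bal. Qed.

Definition cofree_hom : grHom (extMod N) (extMod (extMod N)).
Proof.
exists (fun n => @cofree_coact H (Delta H) N n) => [n|i j k e a].
  exact: cofreeD.
apply: tens_ext => [t u|t u|p q e' g x].
- by rewrite actDr cofreeD.
- by rewrite cofreeD actDr.
- rewrite [act e a _](tact_pure e a e' erefl (deg_addl e e')) !cofree_pure.
  have -> : Delta H (i + p) (rmul erefl (etaL H i a) g) =
      act erefl a (Delta H p g) by apply: (hfun_act (Delta H)).
  exact: (sl_act (tmapd_linear (tpure_linear x))).
Defined.

End Cofree.

Lemma cofree_coassoc (N : grMod A) n (t : extMod N n) :
  extMap (cofree_hom N) n (cofree_hom N n t) =
  cofree_hom (extMod N) n (cofree_hom N n t).
Proof.
move: t; apply: tens_ext => [t u|t u|i j e g x]; try by rewrite !hfunD.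
rewrite [cofree_hom N n _]cofree_pure.
have rx := tpure_linear x; have sx := tmapd_linear rx.
transitivity (tmapd (tmapd (X := leftGamma H) (Y := extMod N)
    (fun q r (e' : q + j = r) (b : G q) => tpure e' b x)) e
    (extMap (Delta H) i (Delta H i g))).
  move: (Delta H i g); apply: tens_ext => [t u|t u|p q e' a b].
  - by rewrite (tmapdD rx) [LHS]hfunD.
  - by rewrite (hfunD (extMap (Delta H))) (tmapdD sx).
  rewrite extMap_pure (tmapd_pure rx e e' erefl (deg_addr e e')).
  rewrite [LHS]extMap_pure (tmapd_pure sx e e' erefl (deg_addr e e')).
  by congr tpure; apply: cofree_pure.
rewrite Delta_coassoc; move: (Delta H i g).
apply: tens_ext => [t u|t u|p q e' a b].
- by rewrite [cofree_coact _ _]cofreeD (tmapdD sx).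
- by rewrite (tmapdD rx) [LHS]cofreeD.
rewrite (tmapd_pure rx e e' erefl (deg_addr e e')).
rewrite cofree_pure [cofree_hom _ _ _]cofree_pure.
move: (Delta H p a); apply: tens_ext => [t u|t u|k l f c d].
- by rewrite (tmapdD (tpure_linear b)) (tmapdD sx).
- by rewrite (tmapdD (tpure_linear _)).
have E : k + (l + (q + j)) = n by rewrite !addrA f e'.
rewrite (tmapd_pure (tpure_linear b) e' f erefl (deg_addr e' f)).
have E1 : l + q + j = l + (q + j) by rewrite addrA.
rewrite (tmapd_pure sx e (deg_addr e' f) E1 E).
rewrite (tmapd_pure (tpure_linear _) _ f erefl E).
by rewrite (tmapd_pure rx E1 erefl erefl erefl).
Qed.

Lemma counit_actD (N : grMod A) n (t u : extMod N n) :
  counit_act (eps H) (t + u) = counit_act (eps H) t + counit_act (eps H) u.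
Proof. exact/tliftD/counit_act_bal. Qed.

Lemma cofree_counit (N : grMod A) n (t : extMod N n) :
  counit_act (eps H) (cofree_hom N n t) = t.
Proof.
move: t; apply: tens_ext => [t u|//|i j e g x].
  by rewrite hfunD; apply: counit_actD.
rewrite /= cofree_pure -[in RHS](Delta_counitl g).
have rx := tpure_linear x.
move: (Delta H i g); apply: tens_ext => [t u|t u|p q e' a b].
- by rewrite (tmapdD rx) counit_actD.
- by rewrite counit_actD (balDl (tpure_bal N n)).
rewrite (tmapd_pure rx e e' erefl (deg_addr e e')) !counit_act_pure.
exact: tact_pure.
Qed.

End Balanced.

Section Comodules.
Variable H : hopfAlgebroid.

Record comod := Comod {
  cmod :> grMod (uA H);
  coact : grHom cmod (extMod cmod);
  coact_coassoc : forall n (x : cmod n),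
    extMap coact n (coact n x) = cofree_coact (Delta H) (coact n x);
  coact_counit : forall n (x : cmod n), counit_act (eps H) (coact n x) = x
}.

Record comodHom (M N : comod) := ComodHom {
  chom :> grHom M N;
  chom_coact : forall n (x : M n),
    coact N n (chom n x) = extMap chom n (coact M n x)
}.

Lemma comodHom_ext (M N : comod) (f g : comodHom M N) :
  (forall n (x : M n), f n x = g n x) -> f = g.
Proof.
case: f g => [f fP] [g gP] /= /grHom_ext fg.
by case: _ / fg gP => gP; congr ComodHom; apply: Prop_irrelevance.
Qed.

Lemma extMap_id (X : grMod (uA H)) n (t : extMod X n) :
  extMap (hid X) n t = t.
Proof.
move: t; apply: tens_ext => [t u|//|i j e g x]; first exact: hfunD.
exact: extMap_pure.
Qed.

Lemma extMap_comp (X Y Z : grMod (uA H)) (g : grHom Y Z) (f : grHom X Y) n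
    (t : extMod X n) :
  extMap (hcomp g f) n t = extMap g n (extMap f n t).
Proof.
move: t; apply: tens_ext => [t u|t u|i j e a x]; try by rewrite !hfunD.
by rewrite !extMap_pure.
Qed.

Lemma extMap_zero (X Y : grMod (uA H)) n (t : extMod X n) :
  extMap (hzero X Y) n t = 0.
Proof.
move: t; apply: tens_ext => [t u|t u|i j e g x]; first exact: hfunD.
  by rewrite addr0.
rewrite extMap_pure /=.
by apply: (@addIr _ (tpure e g 0)); rewrite -(balDr (tpure_bal Y n)) !add0r.
Qed.

Definition cid (M : comod) : comodHom M M.
Proof. by exists (hid M) => n x; rewrite extMap_id. Defined.

Definition ccomp (M N P : comod) (g : comodHom N P) (f : comodHom M N) :
  comodHom M P.
Proof.
by exists (hcomp g f) => n x; rewrite extMap_comp /= !chom_coact.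
Defined.

Definition czero (M N : comod) : comodHom M N.
Proof. by exists (hzero M N) => n x; rewrite extMap_zero /= raddf0. Defined.

(* The extended comodule functor E. *)
Definition ext (N : grMod (uA H)) : comod :=
  @Comod (extMod N) (cofree_hom N)
    (@cofree_coassoc H N) (@cofree_counit H N).

Definition extHom (X Y : grMod (uA H)) (f : grHom X Y) :
  comodHom (ext X) (ext Y).
Proof.
exists (extMap f) => n t.
change (cofree_hom Y n (extMap f n t) =
        extMap (extMap f) n (cofree_hom X n t)).
move: t; apply: tens_ext => [t u|t u|i j e g x].
- by rewrite (hfunD (extMap f)) [LHS](hfunD (cofree_hom Y)).
- by rewrite (hfunD (cofree_hom X)) hfunD.
rewrite extMap_pure [cofree_hom Y n _]cofree_pure [cofree_hom X n _]cofree_pure.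
move: (Delta H i g).
have rx := tpure_linear x; have ry := tpure_linear (f j x).
apply: tens_ext => [t u|t u|p q e' a b].
- exact: (tmapdD ry).
- by rewrite (tmapdD rx) hfunD.
rewrite (tmapd_pure ry e e' erefl (deg_addr e e')).
by rewrite (tmapd_pure rx e e' erefl (deg_addr e e')) !extMap_pure.
Defined.

End Comodules.

Section Relative.
Variable H : hopfAlgebroid.
Local Notation A := (uA H).

(* Flatness of Gamma as a right A-module; the conjugation makes this equivalent
   to flatness as a left A-module. *)
Definition Gamma_flat :=
  forall (X Y : grMod A) (f : grHom X Y), hinj f -> hinj (extMap (H := H) f).

(* Likewise, left and right projectivity are equivalent. *)
Definition Gamma_projective := gr_projective (leftGamma H).

(* When Gamma is flat, kernels and cokernels of comodules are computed on the
   underlying A-modules, hence so is exactness. *)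
Definition short_exact (K L M : comod H) (i : comodHom K L)
    (p : comodHom L M) :=
  [/\ hinj i, hsurj p & hexact i p].

Definition A_split (K L M : comod H) (i : comodHom K L) (p : comodHom L M) :=
  exists (r : grHom L K) (s : grHom M L),
    [/\ hcomp r i = hid K, hcomp p s = hid M
      & forall n (x : L n), i n (r n x) + s n (p n x) = x].

Definition allowable (K L M : comod H) (i : comodHom K L)
    (p : comodHom L M) :=
  short_exact i p /\ A_split i p.

Definition rel_mono (K L : comod H) (i : comodHom K L) :=
  exists (M : comod H) (p : comodHom L M), allowable i p.

Definition rel_epi (L M : comod H) (p : comodHom L M) :=
  exists (K : comod H) (i : comodHom K L), allowable i p.

Definition rel_injective (J : comod H) :=
  forall (K L : comod H) (i : comodHom K L), rel_mono i ->
  forall f : comodHom K J, exists g : comodHom L J, ccomp g i = f.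

Definition comod_mono (K L : comod H) (i : comodHom K L) :=
  forall (X : comod H) (f g : comodHom X K), ccomp i f = ccomp i g -> f = g.

Definition comod_injective (J : comod H) :=
  forall (K L : comod H) (i : comodHom K L), comod_mono i ->
  forall f : comodHom K J, exists g : comodHom L J, ccomp g i = f.

Section Trace.
Variable M : comod H.

Inductive itr : forall n, M n -> Prop :=
| itr_0 n : itr (0 : M n)
| itr_im (J : comod H) (f : comodHom J M) n (x : J n) :
    rel_injective J -> itr (f n x)
| itr_add n (x y : M n) : itr x -> itr y -> itr (x + y).

(* The relatively injective trace of M. *)
Definition Itr : grSub M.
Proof.
exists itr => [n|n x y Ix Iy|i j k e a x].
- exact: itr_0.
- apply: itr_add => //; elim: Iy => {n x y Ix} [n|J f n y Jinj|n x y _ ? _ ?].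
  + by rewrite oppr0; apply: itr_0.
  + by rewrite -raddfN; apply: itr_im.
  + by rewrite opprD; apply: itr_add.
- move=> Ix; elim: Ix k e => {j x} [j|J f j x Jinj|j x y _ IHx _ IHy] k e.
  + by rewrite raddf0; apply: itr_0.
  + by rewrite -hfun_act; apply: itr_im.
  + by rewrite actDr; apply: itr_add.
Defined.

End Trace.

Definition rel_cotorsion (M : comod H) :=
  forall J : comod H, rel_injective J ->
  forall f : comodHom J M, f = czero J M.

Definition cotorsion (M : comod H) :=
  forall J : comod H, comod_injective J ->
  forall f : comodHom J M, f = czero J M.

(* A right adjoint V of the extended comodule functor, together with the
   adjunction isomorphism. *)
Record rightAdjoint := RightAdjoint {
  Vobj :> comod H -> grMod A;
  Vmap : forall M N : comod H, comodHom M N -> grHom (Vobj M) (Vobj N);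
  Vmap_id : forall M, Vmap (cid M) = hid (Vobj M);
  Vmap_comp : forall (M N P : comod H) (g : comodHom N P) (f : comodHom M N),
    Vmap (ccomp g f) = hcomp (Vmap g) (Vmap f);
  Vadj : forall (N : grMod A) (M : comod H),
    comodHom (ext N) M -> grHom N (Vobj M);
  Vadj_bij : forall N M, bijective (@Vadj N M);
  Vadj_natl : forall (N N' : grMod A) (M : comod H) (h : grHom N' N)
      (f : comodHom (ext N) M),
    Vadj (ccomp f (extHom h)) = hcomp (Vadj f) h;
  Vadj_natr : forall (N : grMod A) (M M' : comod H) (k : comodHom M M')
      (f : comodHom (ext N) M),
    Vadj (ccomp k f) = hcomp (Vmap k) (Vadj f)
}.

Lemma Vmap_zero (V : rightAdjoint) (M N : comod H) :
  Vmap V (czero M N) = hzero (V M) (V N).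
Proof.
have [phi _ phiK] := Vadj_bij V (V M) M.
have adj0 (X : grMod A) (P : comod H) :
    Vadj V (czero (ext X) P) = hzero X (V P).
  have [psi _ psiK] := Vadj_bij V X P.
  have -> : czero (ext X) P = ccomp (psi (hzero X (V P))) (extHom (hzero X X)).
    apply: comodHom_ext => n x.
    change (0 = psi (hzero X (V P)) n (extMap (hzero X X) n x)).
    by rewrite extMap_zero raddf0.
  by rewrite Vadj_natl psiK; apply: grHom_ext.
have -> : Vmap V (czero M N) = hcomp (Vmap V (czero M N)) (hid (V M)).
  exact: grHom_ext.
rewrite -(phiK (hid (V M))) -Vadj_natr -adj0; congr Vadj.
exact: comodHom_ext.
Qed.

Record resolution (M : comod H) := Resolution {
  res :> nat -> comod H;
  rdif : forall k, comodHom (res k) (res k.+1);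
  raug : comodHom M (res 0);
  raug_inj : hinj raug;
  rexact0 : hexact raug (rdif 0);
  rexact : forall k, hexact (rdif k) (rdif k.+1)
}.

Definition injective_resolution (M : comod H) (I : resolution M) :=
  forall k, comod_injective (I k).

Definition rel_injective_resolution (M : comod H) (J : resolution M) :=
  (forall k, rel_injective (J k)) /\
  (forall k, exists (Z : comod H) (p : comodHom (J k) Z)
      (i : comodHom Z (J k.+1)),
    [/\ rel_epi p, rel_mono i & rdif J k = ccomp i p]).

(* The complex V(J^0) -> V(J^1) -> ... , without the augmentation. *)
Definition Vcochain (V : rightAdjoint) (M : comod H) (J : resolution M) :
  cochain A.
Proof.
exists (fun k => V (J k)) (fun k => Vmap V (rdif J k)) => k.
rewrite -Vmap_comp -Vmap_zero; congr Vmap; apply: comodHom_ext => n x.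
by apply: (proj2 (@rexact M J k n _)); exists x.
Defined.

(* R^nV(M), resp. R^n_rel V(M), computed by the resolution J. *)
Definition derivedV (V : rightAdjoint) (M : comod H) (J : resolution M) k :
  grMod A := cohomology (Vcochain V J) k.

End Relative.

(* Main.v *)
(* (1), (2): a comodule J is a summand of E(J) when it is relatively injective,
   and maps E(N) -> M are maps N -> V(M), so V(M) = 0 iff M receives no nonzero
   map from a relatively injective comodule.  Over a field every monomorphism
   splits A-linearly, so relatively injective comodules are injective.
   (3): elements of V(M) of degree d are comodule maps Γ ⊗ A[d] -> M, and
   Γ ⊗ A[d] is A-projective, so V E is exact.  Hence short exact sequences of
   comodules, split over A or not, have exact sequences of cobar complexes after
   applying V, and comodules acyclic for R_rel V behave as for an ordinary right
   derived functor.  Both resolutions consist of relatively injective, hence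
   acyclic, objects, so V is exact on the mapping cone of a comparison map from
   the relative injective resolution to the injective one. *)

Require Import Defs.
From mathcomp Require Import all_boot all_order all_algebra.
From mathcomp Require Import boolp classical_sets.

Set Implicit Arguments.
Unset Strict Implicit.
Unset Printing Implicit Defensive.

Import GRing.Theory.
Local Open Scope ring_scope.

(** * Graded modules: maps given by graphs, subquotients, quotients and submodules *)

Section Modules.
Variable A : grRing.
Implicit Types K L X Y Z : grMod A.

Lemma hfunE X Y (f g : grHom X Y) : f = g -> forall n (x : X n), f n x = g n x.
Proof. by move->. Qed.

Lemma hcompE X Y Z (f : grHom X Y) (g : grHom Y Z) (h : grHom X Z) :
  hcomp g f = h -> forall n x, g n (f n x) = h n x.
Proof. by move<-. Qed.

Lemma hcomp_app X Y Z (g : grHom Y Z) (f : grHom X Y) n x :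
  hcomp g f n x = g n (f n x).
Proof. by []. Qed.

Lemma hfun0 X Y (f : grHom X Y) n : f n 0 = 0.
Proof. exact: raddf0. Qed.

Lemma hfunB X Y (f : grHom X Y) n x y : f n (x - y) = f n x - f n y.
Proof. exact: raddfB. Qed.

Lemma act0l X i j k (e : i + j = k) (x : X j) : act e (0 : A i) x = 0.
Proof. by apply: (@addIr _ (act e 0 x)); rewrite -actDl !add0r. Qed.

Definition hadd X Y (f g : grHom X Y) : grHom X Y.
Proof.
exists (fun n x => f n x + g n x) => [n x y|i j k e a x].
  by rewrite !hfunD addrACA.
by rewrite !hfun_act actDr.
Defined.

Definition hopp X Y (f : grHom X Y) : grHom X Y.
Proof.
exists (fun n x => - f n x) => [n x y|i j k e a x].
  by rewrite hfunD opprD.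
by rewrite hfun_act raddfN.
Defined.

(** Choice turns a functional graph closed under the operations into a map. This serves for maps
    defined through lifts or representatives. *)
Lemma hom_of_relation X Y (R : forall n, X n -> Y n -> Prop) :
  (forall n x, exists y, R n x y) ->
  (forall n x y y', R n x y -> R n x y' -> y = y') ->
  (forall n x x' y y', R n x y -> R n x' y' -> R n (x + x') (y + y')) ->
  (forall i j k (e : i + j = k) (a : A i) x y,
    R j x y -> R k (act e a x) (act e a y)) ->
  exists f : grHom X Y, forall n x, R n x (f n x).
Proof.
move=> tot fn RD RA.
pose f n x := projT1 (cid (tot n x)).
have fP n x : R n x (f n x) by rewrite /f; case: cid.
have fD n x y : f n (x + y) = f n x + f n y by apply: fn (fP _ _) _; apply: RD.
have fA i j k (e : i + j = k) (a : A i) x : f k (act e a x) = act e a (f j x).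
  by apply: fn (fP _ _) _; apply: RA.
by exists (GrHom fD fA).
Qed.

Lemma hinj_lift K L X (i : grHom K L) (f : grHom X L) :
  hinj i -> (forall n x, exists y, i n y = f n x) ->
  exists g : grHom X K, hcomp i g = f.
Proof.
move=> ii fi.
have [] := @hom_of_relation X K (fun n x y => i n y = f n x).
- exact: fi.
- by move=> n x y y' E E'; apply: ii; rewrite E E'.
- by move=> n x x' y y' E E'; rewrite !hfunD E E'.
- by move=> m j k e a x y E; rewrite !hfun_act E.
by move=> g gP; exists g; apply: grHom_ext => n x; apply: gP.
Qed.

Lemma hsurj_lift K L X (p : grHom K L) (f : grHom K X) :
  hsurj p -> (forall n x, p n x = 0 -> f n x = 0) ->
  exists g : grHom L X, hcomp g p = f.
Proof.
move=> sp pf.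
have pf' n x x' : p n x = p n x' -> f n x = f n x'.
  by move=> E; apply/eqP; rewrite -subr_eq0 -hfunB pf // hfunB E subrr.
have [] := @hom_of_relation L X (fun n y z => forall x, p n x = y -> f n x = z).
- by move=> n y; have [x <-] := sp n y; exists (f n x) => x' /pf'.
- by move=> n y z z'; have [x <-] := sp n y => E E'; rewrite -(E x) // -(E' x).
- move=> n y y'; have [x <-] := sp n y; have [x' <-] := sp n y' => z z' E E' w.
  by rewrite -hfunD => /pf'; rewrite hfunD (E x) // (E' x').
- move=> i j k e a y z; have [x <-] := sp j y => E w.
  by rewrite -hfun_act => /pf'; rewrite hfun_act (E x).
by move=> g gP; exists g; apply: grHom_ext => n x; apply/esym/gP.
Qed.

Lemma bijective_grIso X Y (f : grHom X Y) : hinj f -> hsurj f -> grIso X Y.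
Proof.
move=> fi fs; have [g fg] : exists g, hcomp f g = hid Y.
  by apply: hinj_lift => // n y; apply: fs.
exists f, g; split=> //; apply: grHom_ext => n x; apply: fi.
exact: (hfunE fg).
Qed.

Lemma grIso_sym X Y : grIso X Y -> grIso Y X.
Proof. by move=> [f [g [fg gf]]]; exists g, f. Qed.

Lemma smemD Y (S : grSub Y) n (x y : Y n) :
  smem S x -> smem S y -> smem S (x + y).
Proof.
move=> Sx Sy; rewrite -[y]opprK; apply: smemB => //.
by rewrite -sub0r; apply: smemB Sy; apply: smem0.
Qed.

Section Subquotients.
Variables (Y : grMod A) (S B : grSub Y).

Definition sqclass n (x : Y n) (Sx : S n x) : subquot S B n :=
  sqpi B (exist _ x (introT (spredP S x) Sx)).

Lemma sqclass_eq n (x x' : Y n) (Sx : S n x) (Sx' : S n x') :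
  sqclass Sx = sqclass Sx' <-> B n (x - x').
Proof. exact: sqpi_eqP. Qed.

Lemma sqclassP n (u : subquot S B n) : exists x (Sx : S n x), u = sqclass Sx.
Proof.
have -> : u = sqpi B (sqrepr (u : sqcar S B n)) by rewrite sqreprK.
case: (sqrepr _) => x Sx; exists x, (elimT (spredP S x) Sx).
by congr sqpi; apply: val_inj.
Qed.

Lemma sqclassD n (x x' : Y n) (Sx : S n x) (Sx' : S n x')
    (Sxx : S n (x + x')) : sqclass Sxx = sqclass Sx + sqclass Sx'.
Proof. by rewrite [RHS](esym (sqpiD _ _ _)); congr sqpi; apply: val_inj. Qed.

Lemma sqclass_act i j k (e : i + j = k) (a : A i) (x : Y j) (Sx : S j x)
    (Sax : S k (act e a x)) : sqclass Sax = act e a (sqclass Sx).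
Proof. by rewrite [RHS]sqact_pi; congr sqpi; apply: val_inj. Qed.

Lemma sqclass_eq0 n (x : Y n) (Sx : S n x) : sqclass Sx = 0 <-> B n x.
Proof.
rewrite -[X in B n X]subr0 -(sqclass_eq Sx (smem0 S n)).
suff -> : sqclass (smem0 S n) = 0 by [].
have S00 : S n (0 + 0) by rewrite addr0; apply: smem0.
apply: (@addIr _ (sqclass (smem0 S n))); rewrite add0r -(sqclassD _ _ S00).
by apply/sqclass_eq; rewrite addr0 subr0; apply: smem0.
Qed.

End Subquotients.

Definition fullSub Y : grSub Y.
Proof. by exists (fun _ _ => True). Defined.

Definition quotMod Y (B : grSub Y) : grMod A := subquot (fullSub Y) B.

Definition quotHom Y (B : grSub Y) : grHom Y (quotMod B).
Proof.
exists (fun n x => @sqclass Y (fullSub Y) B n x I) => [n x y|i j k e a x].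
  exact: sqclassD.
exact: sqclass_act.
Defined.

Lemma quotHom_surj Y (B : grSub Y) : hsurj (quotHom B).
Proof. by move=> n u; have [x [[] ->]] := sqclassP u; exists x. Qed.

Lemma quotHom_eq0 Y (B : grSub Y) n (x : Y n) : quotHom B n x = 0 <-> B n x.
Proof. exact: sqclass_eq0. Qed.

(** Classes modulo zero have a single representative in Y, and the inclusion sends each class to
    it. *)
Lemma submodule_inclusion Y (S : grSub Y) :
  exists (X : grMod A) (i : grHom X Y),
    hinj i /\ forall n y, S n y <-> exists x, i n x = y.
Proof.
pose R n (u : subquot S (zeroSub Y) n) (y : Y n) :=
  exists Sy : S n y, u = sqclass _ Sy.
have RE n u y : R n u y -> forall y', R n u y' -> y = y'.
  move=> [Sy ->] y' [Sy' /sqclass_eq /= /eqP].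
  by rewrite subr_eq0 => /eqP.
have [] := @hom_of_relation _ Y R.
- by move=> n u; have [x [Sx ->]] := sqclassP u; exists x, Sx.
- by move=> n x y y' /RE; apply.
- move=> n u u' y y' [Sy ->] [Sy' ->].
  have Syy : S n (y + y') by apply: smemD.
  by exists Syy; apply/esym/sqclassD.
- move=> i j k e a u y [Sy ->]; exists (smem_act e a Sy).
  exact/esym/sqclass_act.
move=> i iP; exists (subquot S (zeroSub Y)), i; split=> [n u u' E|n y].
  have [Sy ->] := iP n u; have [Sy' ->] := iP n u'.
  by apply/sqclass_eq; rewrite /= E subrr.
split=> [Sy|[x <-]]; last by have [] := iP n x.
exists (sqclass _ Sy); apply: RE (iP n _) _ _.
by exists Sy.
Qed.

End Modules.

(** * The functor Γ ⊗ - on graded modules: additivity and right exactness *)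

Section TensorFunctor.
Variable H : hopfAlgebroid.
Local Notation A := (uA H).
Implicit Types X Y Z : grMod A.

Lemma extMap_eq0 X Y (f : grHom X Y) n (t : extMod X n) :
  (forall m x, f m x = 0) -> extMap f n t = 0.
Proof.
by move=> f0; rewrite (_ : f = hzero X Y) ?extMap_zero //; apply: grHom_ext.
Qed.

Lemma extMap_eqid X (f : grHom X X) n (t : extMod X n) :
  (forall m x, f m x = x) -> extMap f n t = t.
Proof.
by move=> f1; rewrite (_ : f = hid X) ?extMap_id //; apply: grHom_ext.
Qed.

Lemma extMap_add X Y (f g : grHom X Y) n (t : extMod X n) :
  extMap (hadd f g) n t = extMap f n t + extMap g n t.
Proof.
move: t; apply: tens_ext => [t u|t u|i j e g' x]; first exact: hfunD.
  by rewrite !hfunD addrACA.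
by rewrite !extMap_pure (balDr (tpure_bal Y n)).
Qed.

Lemma extMap_opp X Y (f : grHom X Y) n (t : extMod X n) :
  extMap (hopp f) n t = - extMap f n t.
Proof.
apply/eqP; rewrite -subr_eq0 opprK -extMap_add extMap_eq0 // => m x.
exact: addNr.
Qed.

Lemma extMap_surj X Y (p : grHom X Y) : hsurj p -> hsurj (extMap (H := H) p).
Proof.
move=> sp n; apply: tens_ind => [|t u [x <-] [y <-]|i j e g y].
- by exists 0; apply: hfun0.
- by exists (x + y); rewrite hfunD.
- by have [x <-] := sp j y; exists (tpure e g x); rewrite extMap_pure.
Qed.

(* A set-theoretic section s of p gives an inverse g ⊗ z |-> [g ⊗ s z] of the
   map (Γ ⊗ Y) / im (Γ ⊗ i) -> Γ ⊗ Z induced by p. *)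
Lemma extMap_exact X Y Z (i : grHom X Y) (p : grHom Y Z) :
  hsurj p -> hexact i p -> hexact (extMap (H := H) i) (extMap p).
Proof.
move=> sp ip n t; split=> [|[u <-]]; last first.
  by rewrite -extMap_comp extMap_eq0 // => m x; apply/(ip m); exists x.
pose q := quotHom (imSub (extMap (H := H) i)).
(* Modulo the image, g ⊗ y depends only on p y. Hence the choices made by s do not matter and the
   inverse is balanced. *)
have qp k l (e : k + l = n) g y y' : p l y = p l y' ->
    q n (tpure e g y) = q n (tpure e g y').
  move=> E; have /(ip l)[x xE] : p l (y - y') = 0 by rewrite hfunB E subrr.
  have -> : y = y' + i l x by rewrite xE addrC subrK.
  rewrite (balDr (tpure_bal Y n)) (hfunD q); apply/eqP.
  rewrite -subr_eq0 addrAC subrr add0r; apply/eqP/quotHom_eq0.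
  by exists (tpure e g x); apply: extMap_pure.
pose s l z := projT1 (cid (sp l z)).
have sK l z : p l (s l z) = z by rewrite /s; case: cid.
have fB : balanced (fun k l (e : k + l = n) (g : uG H k) (z : Z l) =>
    q n (tpure e g (s l z))).
  split=> [k l e g h z|k l e g y z|k l m kl lm e1 e2 e3 e4 g a z].
  - by rewrite (balDl (tpure_bal Y n)) (hfunD q).
  - rewrite -(hfunD q) -(balDr (tpure_bal Y n)); apply: qp.
    by rewrite hfunD !sK.
  - rewrite (balA (tpure_bal Y n) e1 e2 e3 e4); apply: qp.
    by rewrite hfun_act !sK.
have qE : forall t, tlift (fun k l (e : k + l = n) (g : uG H k) (z : Z l) =>
    q n (tpure e g (s l z))) (extMap p n t) = q n t.
  apply: tens_ext => [u v|u v|k l e g y].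
  - by rewrite hfunD (tliftD fB).
  - exact: hfunD.
  - by rewrite extMap_pure (tlift_pure fB); apply: qp; rewrite sK.
move=> t0; apply/(quotHom_eq0 (imSub (extMap i))); rewrite -/q -qE t0.
set f := tlift _; have fD : forall u v, f (u + v) = f u + f v by apply: tliftD.
by apply: (@addIr _ (f 0)); rewrite -fD !add0r.
Qed.

End TensorFunctor.

(** * Extended comodules as right adjoint to the forgetful functor *)

Section Cofree.
Variable H : hopfAlgebroid.
Local Notation A := (uA H).
Implicit Types (N : grMod A) (X Y M : comod H).

(** The counit of the adjunction between the forgetful functor to A-modules and [ext]. *)
Definition counitHom N : grHom (extMod N) N.
Proof.
exists (fun n t => counit_act (eps H) t) => [n t u|i j k e a].
  exact: counit_actD.
apply: tens_ext => [t u|t u|p q e' g x].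
- by rewrite actDr counit_actD.
- by rewrite counit_actD actDr.
rewrite [act e a _](tact_pure e a e' erefl (deg_addl e e')) !counit_act_pure.
by rewrite rhomM eps_etaL; apply: actA.
Defined.

Lemma counitHom_natural N N' (f : grHom N N') n t :
  counitHom N' n (extMap f n t) = f n (counitHom N n t).
Proof.
move: t; apply: tens_ext => [t u|t u|i j e g x].
- by rewrite !hfunD.
- by rewrite !hfunD.
by rewrite extMap_pure /= !counit_act_pure hfun_act.
Qed.

(** A triangle identity of this adjunction. It comes from the right counit law of Γ: the scalar eps
    b passes across the tensor sign as etaR (eps b). *)
Lemma extMap_counit_cofree N n (t : extMod N n) :
  extMap (counitHom N) n (cofree_hom N n t) = t.
Proof.
move: t; apply: tens_ext => [t u|//|i j e g x]; first by rewrite !hfunD.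
rewrite [cofree_hom N n _]cofree_pure -[g in RHS](Delta_counitr g).
have rx := tpure_linear x; move: (Delta H i g).
have tD : forall t u, tmul_map (fun _ a => a)
    (fun i b => etaR H i (eps H i b)) (t + u) =
    tmul_map (fun _ a => a) (fun i b => etaR H i (eps H i b)) t +
    tmul_map (fun _ a => a) (fun i b => etaR H i (eps H i b)) u :> uG H i.
  exact: (tliftD (counitr_bal H i)).
apply: tens_ext => [t u|t u|p q e' a b].
- by rewrite (tmapdD rx) hfunD.
- by rewrite tD (balDl (tpure_bal N n)).
rewrite (tmapd_pure rx e e' erefl (deg_addr e e')) extMap_pure.
rewrite /= counit_act_pure [tmul_map _ _ _](tlift_pure (counitr_bal H i)).
exact/esym/(balA (tpure_bal N n)).
Qed.

Definition coactHom M : comodHom M (ext M).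
Proof.
by exists (coact M) => n x; rewrite -[RHS]/(extMap _ n _) coact_coassoc.
Defined.

(** The comodule map that corresponds to h under the adjunction; by [coliftK] and [counit_colift],
    composing with the counit is the inverse operation. *)
Definition colift M N (h : grHom M N) : comodHom M (ext N) :=
  ccomp (extHom h) (coactHom M).

Lemma coliftK M N (h : grHom M N) : hcomp (counitHom N) (colift h) = h.
Proof.
apply: grHom_ext => n x; rewrite /= [LHS]counitHom_natural.
by congr (h n _); apply: coact_counit.
Qed.

Lemma counit_colift M N (f : comodHom M (ext N)) :
  colift (hcomp (counitHom N) f) = f.
Proof.
apply: comodHom_ext => n x.
rewrite -[LHS]/(extMap (hcomp (counitHom N) f) n (coact M n x)) extMap_comp.
by rewrite -(chom_coact f) [LHS]extMap_counit_cofree.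
Qed.

Lemma ext_hom_eq M N (f g : comodHom M (ext N)) :
  hcomp (counitHom N) f = hcomp (counitHom N) g -> f = g.
Proof. by rewrite -{2}(counit_colift f) -{2}(counit_colift g) => ->. Qed.

End Cofree.

(** * Kernels, cokernels and relative injectivity of comodules *)

Section Comodules.
Variable H : hopfAlgebroid.
Local Notation A := (uA H).
Implicit Types (N : grMod A) (K L M X Y Z J : comod H).

Lemma comodHom_eq X Y (f g : comodHom X Y) : chom f = chom g -> f = g.
Proof. by move=> E; apply: comodHom_ext => n x; rewrite E. Qed.

(** Compatibility with the coactions can be tested on the image of p, which is everything. *)
Lemma comod_hsurj_lift K L X (p : comodHom K L) (f : comodHom K X) :
  hsurj p -> (forall n x, p n x = 0 -> f n x = 0) ->
  exists g : comodHom L X, ccomp g p = f.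
Proof.
move=> sp pf; have [g gp] := hsurj_lift sp pf.
suff gP : forall n (y : L n), coact X n (g n y) = extMap g n (coact L n y).
  by exists (ComodHom gP); apply: comodHom_eq.
move=> n y; have [x <-] := sp n y.
by rewrite (hcompE gp) chom_coact (chom_coact p) -gp extMap_comp.
Qed.

(** The coaction of L descends to the module cokernel because i respects coactions; the axioms pass
    down along the surjection q. *)
Lemma cokernel_exists K L (i : comodHom K L) :
  exists (C : comod H) (p : comodHom L C), hsurj p /\ hexact i p.
Proof.
pose q := quotHom (imSub i); have sq : hsurj q := @quotHom_surj _ _ _.
have iq : hexact i q by move=> n x; apply: quotHom_eq0.
have [c cq] : exists c, hcomp c q = hcomp (extMap q) (coact L).
  apply: hsurj_lift => // n y /iq[x <-].
  rewrite hcomp_app chom_coact -extMap_comp.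
  by rewrite extMap_eq0 // => m z; apply/iq; exists z.
have cA n x : extMap c n (c n x) = cofree_coact (Delta H) (c n x).
  have [y <-] := sq n x.
  rewrite (hcompE cq) hcomp_app -extMap_comp cq extMap_comp.
  rewrite coact_coassoc; exact/esym/(chom_coact (extHom q)).
have c1 n x : counit_act (eps H) (c n x) = x.
  have [y <-] := sq n x; rewrite (hcompE cq).
  rewrite -[LHS]/(counitHom _ n (extMap q n (coact L n y))) counitHom_natural.
  by congr (q n _); apply: coact_counit.
pose C := Comod cA c1.
have qP n (x : L n) : coact C n (q n x) = extMap q n (coact L n x).
  exact: (hcompE cq).
by exists C, (@ComodHom _ L C q qP).
Qed.

(** The map 1 - i r kills the image of i, so it factors through the cokernel and gives the
    complementary section s. *)
Lemma retract_rel_mono K L (i : comodHom K L) (r : grHom L K) :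
  hcomp r i = hid K -> rel_mono i.
Proof.
move=> ri; have [C [p [sp ip]]] := cokernel_exists i; exists C, p.
have rK n x : r n (i n x) = x by apply: (hcompE ri).
have ii : hinj i by move=> n x y E; rewrite -(rK _ x) E rK.
have [s sE] : exists s, hcomp s p = hadd (hid L) (hopp (hcomp i r)).
  apply: hsurj_lift => // n x /ip[y <-].
  by rewrite -[LHS]/(i n y - i n (r n (i n y))) rK subrr.
split=> //; exists r, s; split=> // [|n x]; last first.
  by rewrite (hcompE sE) -[LHS]/(_ + (x - i n (r n x))) addrC subrK.
apply: grHom_ext => n x; have [y <-] := sp n x.
rewrite -[LHS]/(p n (s n (p n y))) (hcompE sE).
rewrite -[LHS]/(p n (y - i n (r n y))) hfunB.
suff -> : p n (i n (r n y)) = 0 by rewrite subr0.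
by apply/ip; exists (r n y).
Qed.

(** The counit is an A-linear retraction of the coaction. Thus every comodule embeds relatively in
    an extended one. *)
Lemma coact_rel_mono M : rel_mono (coactHom M).
Proof.
apply: (@retract_rel_mono M (ext M) (coactHom M) (counitHom M)).
by apply: grHom_ext => n x; apply: coact_counit.
Qed.

Lemma rel_mono_retract K L (i : comodHom K L) :
  rel_mono i -> exists r : grHom L K, hcomp r i = hid K.
Proof. by move=> [C [p [_ [r [s [ri _ _]]]]]]; exists r. Qed.

Lemma rel_mono_hinj K L (i : comodHom K L) : rel_mono i -> hinj i.
Proof. by move=> [C [p [[]]]]. Qed.

Lemma hinj_comod_mono K L (i : comodHom K L) : hinj i -> comod_mono i.
Proof.
move=> ii X f g E; apply: comodHom_ext => n x; apply: ii.
exact: (hfunE (congr1 (@chom H X L) E)).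
Qed.

(** By adjunction the extension problem becomes one of A-modules, and the A-linear retraction of i
    solves it. *)
Lemma rel_injective_ext N : rel_injective (ext N).
Proof.
move=> K L i /rel_mono_retract[r ri] f.
exists (colift (hcomp (hcomp (counitHom N) f) r)).
apply: ext_hom_eq; apply: grHom_ext => n x.
rewrite -[LHS]/(hcomp (counitHom N) (colift _) n (i n x)) coliftK.
by rewrite -[LHS]/(counitHom N n (f n (hcomp r i n x))) ri.
Qed.

Lemma comod_injective_rel J : comod_injective J -> rel_injective J.
Proof. by move=> Jinj K L i /rel_mono_hinj/hinj_comod_mono/Jinj. Qed.

Lemma rel_injective_retract J :
  rel_injective J ->
  exists r : comodHom (ext J) J, ccomp r (coactHom J) = Defs.cid J.
Proof. by move=> Jinj; apply: Jinj (coact_rel_mono J) _. Qed.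

Lemma retract_rel_injective X J (s : comodHom X J) (r : comodHom J X) :
  ccomp r s = Defs.cid X -> rel_injective J -> rel_injective X.
Proof.
move=> rs Jinj K L i im f; have [g gE] := Jinj _ _ _ im (ccomp s f).
exists (ccomp r g); apply: comodHom_ext => n x.
rewrite -[LHS]/(r n (ccomp g i n x)) gE.
by rewrite -[LHS]/(ccomp r s n (f n x)) rs.
Qed.

Section Flat.
Hypothesis flat : Gamma_flat H.

(** Flatness makes Γ ⊗ i injective, so compatibility with the coactions can be tested after
    composition with it. *)
Lemma comod_hinj_lift K L X (i : comodHom K L) (f : comodHom X L) :
  hinj i -> (forall n x, exists y, i n y = f n x) ->
  exists g : comodHom X K, ccomp i g = f.
Proof.
move=> ii fi; have [g ig] := hinj_lift ii fi.
suff gP : forall n (x : X n), coact K n (g n x) = extMap g n (coact X n x).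
  by exists (ComodHom gP); apply: comodHom_eq.
move=> n x; apply: (flat ii); rewrite -(chom_coact i) -extMap_comp ig.
by rewrite (hcompE ig) chom_coact.
Qed.

(** Right exactness of Γ ⊗ - applies to surjections, so f is factored as f' onto its image followed
    by the inclusion j. Flatness applied to j then shows that Γ ⊗ i is a kernel of Γ ⊗ f, and the
    coaction of L restricts to the module kernel. *)
Lemma kernel_exists L M (f : comodHom L M) :
  exists (K : comod H) (i : comodHom K L), hinj i /\ hexact i f.
Proof.
have [N [i [ii kerE]]] := submodule_inclusion (kerSub f).
have [P [j [ij imE]]] := submodule_inclusion (imSub f).
have [f' jf] : exists f', hcomp j f' = f.
  by apply: hinj_lift => // n x; apply/imE; exists x.
have if' : hexact i f'.
  move=> n x; rewrite -kerE -[smem _ _]/(f n x = 0) -(hcompE jf).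
  by split=> [->|E]; [apply: hfun0 | apply: (ij n); rewrite [LHS]E hfun0].
have sf' : hsurj f'.
  move=> n y; have [x fx] : exists x, f n x = j n y by apply/imE; exists y.
  by exists x; apply: (ij n); rewrite -fx; apply: (hcompE jf).
have eif := extMap_exact (H := H) sf' if'.
have [c ic] : exists c, hcomp (extMap i) c = hcomp (coact L) i.
  apply: hinj_lift => [|n x]; first exact: flat.
  apply/(eif n); apply: (flat ij); rewrite -extMap_comp jf hfun0.
  rewrite -(chom_coact f); have /kerE fx : exists z, i n z = i n x by exists x.
  by rewrite [f n _]fx hfun0.
(* Two uses of flatness embed Γ ⊗ Γ ⊗ N in Γ ⊗ Γ ⊗ L, where the coaction of L is coassociative. *)
have cA n x : extMap c n (c n x) = cofree_coact (Delta H) (c n x).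
  apply: (flat (flat ii)); rewrite -extMap_comp ic extMap_comp.
  rewrite [extMap i n _](hcompE ic) hcomp_app coact_coassoc.
  rewrite -[coact L n _](hcompE ic).
  exact: (chom_coact (extHom i)).
have c1 n x : counit_act (eps H) (c n x) = x.
  apply: ii; rewrite -[counit_act _ _]/(counitHom _ n (c n x)).
  by rewrite -counitHom_natural [extMap i n _](hcompE ic); apply: coact_counit.
pose K := Comod cA c1.
have iP n (x : K n) : coact L n (i n x) = extMap i n (coact K n x).
  exact/esym/(hcompE ic).
by exists K, (@ComodHom _ K L i iP).
Qed.

(** The inclusion of the kernel and the zero map have the same composite with i, hence coincide. *)
Lemma comod_mono_hinj K L (i : comodHom K L) : comod_mono i -> hinj i.
Proof.
move=> mi n x y E; have [Z [k [ki kE]]] := kernel_exists i.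
have k0 : k = czero Z K.
  apply: mi; apply: comodHom_ext => m z; rewrite /= hfun0.
  by apply/(kE m); exists z.
have /(kE n)[z zE] : i n (x - y) = 0 by rewrite hfunB E subrr.
by apply/eqP; rewrite -subr_eq0 -zE k0.
Qed.

End Flat.

End Comodules.

(** * Splitting of monomorphisms over a field, by Zorn's lemma *)

Section FieldSplitting.
Variables (A : grRing) (fA : is_field A).
Variables (K L : grMod A) (i : grHom K L) (ii : hinj i).

Let D (S : set {n & L n}) n (x : L n) := x = 0 \/ S (existT _ n x).

(* D adds the zero vectors, so that the union of the empty chain qualifies. *)
Let independent (S : set {n & L n}) :=
  [/\ forall n (x y : L n), D S x -> D S y -> D S (x - y),
      forall j k l (e : j + k = l) (a : A j) (x : L k), D S x -> D S (act e a x)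
    & forall n (k : K n), D S (i n k) -> k = 0].

Let independent_bigcup (F : set (set {n & L n})) :
  (F `<=` independent)%classic -> total_on F subset ->
  independent (\bigcup_(X in F) X)%classic.
Proof.
move=> Find Ftot; pose U := (\bigcup_(X in F) X)%classic.
have DU n (x : L n) : D U x <-> x = 0 \/ exists2 S, F S & D S x.
  split=> [[->|[S FS Sx]]|[->|[S FS [->|Sx]]]]; try by left.
  - by right; exists S => //; right.
  - by right; exists S.
have sD S S' n (x : L n) : (S `<=` S')%classic -> D S x -> D S' x.
  by move=> SS' [->|/SS' Sx]; [left|right].
split.
- move=> n x y /DU[->|[S FS Sx]] /DU[->|[S' FS' Sy]]; apply/DU.
  + by rewrite subr0; left.
  + by right; exists S' => //; have [+ _ _] := Find _ FS'; apply; [left|].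
  + by rewrite subr0; right; exists S.
  + have [SS'|SS'] := Ftot _ _ FS FS'; right.
      exists S' => //; have [+ _ _] := Find _ FS'; apply=> //.
      exact: sD SS' Sx.
    exists S => //; have [+ _ _] := Find _ FS; apply=> //.
    exact: sD SS' Sy.
- move=> j k l e a x /DU[->|[S FS Sx]]; apply/DU.
    by rewrite raddf0; left.
  by right; exists S => //; have [_ + _] := Find _ FS; apply.
- move=> n k /DU[E|[S FS Sx]]; last by have [_ _ +] := Find _ FS; apply.
  by apply: (@ii n); rewrite E hfun0.
Qed.

(** A maximal graded submodule [D S] that meets the image of i in 0 is a complement of that image,
    and r x is the k with x - i k in [D S]. *)
Lemma field_split : exists r : grHom L K, hcomp r i = hid K.
Proof.
have [S [[SB Sact Sdisj] Smax]] := Zorn_bigcup independent_bigcup.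
have S0 n : D S (0 : L n) by left.
have SN n (x : L n) : D S x -> D S (- x) by rewrite -sub0r; apply: SB.
have SD n (x y : L n) : D S x -> D S y -> D S (x + y).
  by move=> Sx Sy; rewrite -[y]opprK; apply: SB => //; apply: SN.
have cover n (x : L n) : exists k, D S (x - i n k).
  have [//|nx] := pselect (exists k, D S (x - i n k)); exfalso.
  (* [S'] is the sum of [D S] and A x. *)
  pose S' (z : {m & L m}) := exists c j (e : j + n = projT1 z) (a : A j),
    D S c /\ projT2 z = c + act e a x.
  have DS' m (y : L m) : D S' y <-> S' (existT _ m y).
    split=> [[->|//]|]; last by right.
    have e : m - n + n = m by rewrite subrK.
    by exists 0, (m - n), e, 0; split=> //=; rewrite act0l addr0.
  have S'S m (y : L m) : D S y -> D S' y.
    move=> Sy; apply/DS'; have e : m - n + n = m by rewrite subrK.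
    by exists y, (m - n), e, 0; split=> //=; rewrite act0l addr0.
  (* [S'] is strictly larger than S: it contains x, with coefficient 1, whereas x in [D S] would
     allow k = 0. *)
  apply: (Smax S').
    split; last first.
      move=> sub; apply: nx; exists 0; rewrite hfun0 subr0; right; apply: sub.
      exists 0, 0, (add0r n), (rone A); split=> //=.
      by rewrite act1 add0r.
    move=> [m y] Sy; apply/DS'/S'S; by right.
  split.
  - move=> m y z /DS'[c [j [e [a [Sc /= ->]]]]].
    move=> /DS'[c' [j' [e' [a' [Sc' /= ->]]]]].
    apply/DS'; have ej : j' = j by apply: (@addIr _ n); rewrite e e'.
    subst j'; rewrite (Prop_irrelevance e' e).
    exists (c - c'), j, e, (a - a'); split; first exact: SB.
    have -> : act e (a - a') x = act e a x - act e a' x.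
      by apply/eqP; rewrite eq_sym subr_eq -actDl subrK.
    by rewrite /= opprD addrACA.
  - move=> p q l e b y /DS'[c [j [e' [a [Sc /= ->]]]]]; apply/DS'.
    have E : p + j + n = l by rewrite -addrA e'.
    exists (act e b c), (p + j), E, (rmul erefl b a).
    split; first exact: Sact.
    by rewrite raddfD /= (actA erefl E e' e).
  - move=> m k /DS'[c [j [e [a [Sc /= E]]]]].
    have [a0|a0] := eqVneq a 0.
      by apply: Sdisj; rewrite E a0 act0l addr0.
    have [A0 _ Ainv] := fA; case: nx.
    (* The coefficient a is nonzero, so it has degree 0 and an inverse b. From i k = c + a x follows
       x - i (b k) = - b c, which lies in [D S], against the choice of x. *)
    have j0 : j = 0.
      by apply: contrapT => /(A0 _ a)/eqP; apply/negP.
    subst j; have nm : n = m by rewrite -(e : 0 + n = m) add0r.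
    move: k c e Sc E; rewrite /= -nm => k c e Sc E.
    have [b ab] := Ainv (addr0 0) a (elimN eqP a0).
    have ba : rmul (addr0 0) b a = rone A.
      by rewrite (rmulC _ (addr0 0)) koszul0 mulr1z ab.
    exists (act e b k).
    have -> : x = act e b (act e a x).
      by rewrite -(actA (addr0 0) e e e) ba act1.
    have -> : act e a x = i n k - c by rewrite E addrC addKr.
    rewrite raddfB /= -hfun_act addrAC subrr sub0r; apply: SN.
    exact: Sact.
have [r rP] : exists r : grHom L K, forall n x, D S (x - i n (r n x)).
  apply: (@hom_of_relation _ _ _ (fun n x k => D S (x - i n k))).
  - exact: cover.
  - move=> n x k k' Sk Sk'; apply/eqP; rewrite -subr_eq0; apply/eqP/Sdisj.
    have -> : i n (k - k') = (x - i n k') - (x - i n k).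
      by rewrite hfunB opprB [RHS]addrC subrKA.
    exact: SB.
  - move=> n x x' k k' Sk Sk'; rewrite hfunD opprD addrACA; exact: SD.
  - by move=> j k l e a x y Sy; rewrite hfun_act -raddfB; apply: Sact.
exists r; apply: grHom_ext => n k; apply/eqP; rewrite eq_sym -subr_eq0.
apply/eqP/Sdisj; rewrite hfunB; exact: rP.
Qed.

End FieldSplitting.

(** * Cotorsion *)

Section Cotorsion.
Variables (H : hopfAlgebroid) (V : rightAdjoint H).
Implicit Types (N : grMod (uA H)) (J M : comod H).

Lemma Vadj_inj N M : injective (@Vadj H V N M).
Proof. exact/bij_inj/Vadj_bij. Qed.

Lemma Vadj_surj N M (h : grHom N (V M)) : exists f, Vadj V f = h.
Proof. by have [phi _ phiK] := Vadj_bij V N M; exists (phi h). Qed.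

Lemma Vadj_zero N M : Vadj V (czero (ext N) M) = hzero N (V M).
Proof.
have -> : czero (ext N) M = ccomp (czero M M) (czero (ext N) M).
  exact: comodHom_ext.
by rewrite Vadj_natr Vmap_zero; apply: grHom_ext.
Qed.

(** A map f out of a summand J of [ext J] is determined by its composite with the retraction r,
    which is adjoint to a map into V M. Conversely the identity of V M is adjoint to a map from a
    relatively injective comodule. *)
Lemma V_is_zero_rel_cotorsion M : gr_is_zero (V M) <-> rel_cotorsion M.
Proof.
split=> [VM0 J /rel_injective_retract[r rE] f|Mcot n x].
  have fr0 : ccomp f r = czero (ext J) M.
    by apply: Vadj_inj; rewrite Vadj_zero; apply: grHom_ext => n x; apply: VM0.
  apply: comodHom_ext => n x.
  rewrite -[LHS]/(f n (Defs.cid J n x)) -rE.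
  by rewrite -[LHS]/(ccomp f r n (coactHom J n x)) fr0.
have [f fE] := Vadj_surj (hid (V M)).
have f0 := Mcot _ (@rel_injective_ext H _) f.
by rewrite -[LHS]/(hid (V M) n x) -fE f0 Vadj_zero.
Qed.

Lemma Itr_is_zero_rel_cotorsion M :
  rel_cotorsion M <-> forall n (x : M n), smem (Itr M) x -> x = 0.
Proof.
split=> [Mcot n x|M0 J Jinj f]; last first.
  by apply: comodHom_ext => n x; apply: M0; apply: itr_im.
elim=> {n x} [//|J f n x Jinj|n x y _ -> _ ->]; last by rewrite addr0.
by rewrite (Mcot J Jinj f).
Qed.

Lemma field_rel_injective J :
  Gamma_flat H -> is_field (uA H) -> rel_injective J -> comod_injective J.
Proof.
move=> flat fA Jinj K L i mi; apply: Jinj.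
have [r ri] := field_split fA (comod_mono_hinj flat mi).
exact: retract_rel_mono ri.
Qed.

End Cotorsion.

(** * Free modules on one generator *)

Section FreeModule.
Variable A : grRing.

Fact deg_subr (d i j k : int) : i + j = k -> i + (j - d) = k - d.
Proof. by move=> <-; rewrite addrA. Qed.

Definition freeMod (d : int) : grMod A.
Proof.
exists (fun n => A (n - d)) (fun i j k e a x => rmul (deg_subr d e) a x).
- by move=> i j k e a b x; apply: rmulDl.
- by move=> i j k e a x y; apply: rmulDr.
- by move=> i j k ij jk n e1 e2 e3 e4 a b x; apply: rmulA.
- by move=> i e x; apply: rmul1l.
Defined.

Lemma freeMod_actE d i j k (e : i + j = k) (e' : i + (j - d) = k - d)
    (a : A i) (x : freeMod d j) : act e a x = rmul e' a (x : A (j - d)).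
Proof. by congr rmul; apply: Prop_irrelevance. Qed.

Definition freeGen d : freeMod d d :=
  ecast z (A z) (esym (subrr d)) (rone A).

Lemma freeGen_span d n (a : freeMod d n) (e : n - d + d = n) :
  act e (a : A (n - d)) (freeGen d) = a.
Proof.
have e' : n - d + (d - d) = n - d by rewrite subrr addr0.
rewrite (freeMod_actE _ e') /freeGen; move: e'; case: _ / (esym _) => e'.
exact: rmul1r.
Qed.

Lemma act_freeGen d (X : grMod A) (x : X d) (e : d - d + d = d) :
  act e (freeGen d : A (d - d)) x = x.
Proof. by move: e; rewrite /freeGen; case: _ / (esym _) => e; apply: act1. Qed.

Lemma freeMod_hom_exists d (X : grMod A) (x : X d) :
  exists f : grHom (freeMod d) X, f d (freeGen d) = x.
Proof.
pose f n (a : freeMod d n) : X n := act (subrK d n) (a : A (n - d)) x.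
have fD n a b : f n (a + b) = f n a + f n b by apply: actDl.
have fA i j k (e : i + j = k) a b : f k (act e a b) = act e a (f j b).
  exact: actA.
by exists (GrHom fD fA); apply: act_freeGen.
Qed.

Lemma freeMod_hom_eq d (X : grMod A) (f g : grHom (freeMod d) X) :
  f d (freeGen d) = g d (freeGen d) -> f = g.
Proof.
move=> E; apply: grHom_ext => n a.
by rewrite -(freeGen_span a (subrK d n)) !hfun_act E.
Qed.

End FreeModule.

(** * Projectivity of the A-modules Γ ⊗ A[d] *)

Section ProjectiveGenerator.
Variables (H : hopfAlgebroid) (proj : Gamma_projective H).
Local Notation A := (uA H).
Local Notation G := (uG H).

Fact deg_addr2 (d i j k : int) : i + j = k -> i + (j + d) = k + d.
Proof. by move=> <-; rewrite addrA. Qed.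

(** The shift acts from the side opposite to the scalars, so no Koszul sign enters the action. *)
Definition shiftMod (d : int) (X : grMod A) : grMod A.
Proof.
exists (fun n => X (n + d)) (fun i j k e a x => act (deg_addr2 d e) a x).
- by move=> i j k e a b x; apply: actDl.
- by move=> i j k e a x y; apply: actDr.
- by move=> i j k ij jk n e1 e2 e3 e4 a b x; apply: actA.
- by move=> i e x; apply: act1.
Defined.

Definition shiftHom d (X Y : grMod A) (f : grHom X Y) :
  grHom (shiftMod d X) (shiftMod d Y).
Proof.
exists (fun n => f (n + d)) => [n x y|i j k e a x].
  exact: (@hfunD _ _ _ f (n + d) x y).
exact: (@hfun_act _ _ _ f _ _ _ (deg_addr2 d e) a x).
Defined.

Lemma shiftMod_actE d (X : grMod A) i j k (e : i + j = k)
    (e' : i + (j + d) = k + d) (a : A i) (x : shiftMod d X j) :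
  act e a x = act e' a (x : X (j + d)).
Proof. by rewrite (Prop_irrelevance e' (deg_addr2 d e)). Qed.

(* By adjunction a map Γ ⊗ A[d] -> Y amounts to a map Γ -> Y of degree d; a lift
   h of the latter yields the lift g ⊗ a |-> h (g etaR(a)) of the former. *)
Lemma extMod_freeMod_projective d : gr_projective (extMod (freeMod A d)).
Proof.
move=> X Y p f sp; have gen_lin := tpure_linear (freeGen A d).
pose f0 n (g : leftGamma H n) : shiftMod d Y n :=
  f (n + d) (tpure erefl g (freeGen A d)).
have f0D n x y : f0 n (x + y) = f0 n x + f0 n y.
  by rewrite /f0 (slD gen_lin) hfunD.
have f0A i j k (e : i + j = k) (a : A i) x :
    f0 k (act e a x) = act e a (f0 j x).
  have E : i + (j + d) = k + d by rewrite addrA e.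
  by rewrite /f0 (sl_act gen_lin e erefl erefl E) hfun_act (shiftMod_actE _ E).
have sp' : hsurj (shiftHom d p) by move=> n y; apply: sp.
have [h ph] := proj (GrHom f0D f0A) sp'.
(* The lift h, read as a map of degree d whose target degree may be any m equal to q + d. *)
pose hs q m (e : q + d = m) (g : leftGamma H q) : X m :=
  ecast z (X z) e (h q g).
have hs_lin : @shift_linear _ (leftGamma H) X d hs.
  split=> [q m e g g'|i j k r s e e1 e2 e3 a g].
    by case: m / e; apply: (hfunD h).
  case: r / e1 e3; case: s / e2 => e3.
  by rewrite -[LHS]/(h k (act e a g)) hfun_act (shiftMod_actE _ e3).
have p_hs q m (e : q + d = m) g :
    p m (hs q m e g) = f m (tpure e g (freeGen A d)).
  by case: m / e; apply: (hcompE ph).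
have hsM i j q q' m (e1 : i + j = q) (e1' : i + j = q') (e2 : q + d = m)
    (e2' : q' + d = m) (g : G i) (g' : G j) :
    hs q m e2 (rmul e1 g g') = hs q' m e2' (rmul e1' g g').
  case: q' / e1' e2'; case: q / e1 e2 => e2 e2'.
  by congr hs; apply: Prop_irrelevance.
have degE i j m : i + j = m -> i + (j - d) + d = m.
  by move=> <-; rewrite -addrA subrK.
(* The element a lies in degree j - d of A; multiplying by etaR a and then applying h gives total
   degree i + j = m. *)
pose F m i j (e : i + j = m) (g : G i) (a : freeMod A d j) : X m :=
  hs _ m (degE i j m e) (rmul erefl g (etaR H (j - d) a)).
have F_bal m : balanced (F m).
  split=> [i j e g g' a|i j e g a b|i j k ij jk e1 e2 e3 e4 g a b].
  - by rewrite /F rmulDl (slD hs_lin).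
  - by rewrite /F -(slD hs_lin) -rmulDr -rhomD.
  - have E : j + (k - d) = jk - d by rewrite addrA e3.
    have E' : ij + (k - d) = i + (jk - d) by rewrite -e1 -addrA E.
    rewrite /F (freeMod_actE e3 E) rhomM -(rmulA e1 E'); exact: hsM.
pose g0 m := tlift (F m).
have g0D m t u : g0 m (t + u) = g0 m t + g0 m u by apply: tliftD.
have g0_pure m i j (e : i + j = m) g a : g0 m (tpure e g a) = F m i j e g a.
  exact: tlift_pure.
have g0A i j k (e : i + j = k) (a : A i) :
    forall t : extMod (freeMod A d) j, g0 k (act e a t) = act e a (g0 j t).
  apply: tens_ext => [t u|t u|q r e' g b].
  - by rewrite actDr g0D.
  - by rewrite g0D actDr.
  rewrite [act e a _](tact_pure e a e' erefl (deg_addl e e')) !g0_pure.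
  have E1 : i + q + (r - d) = i + (q + (r - d)) by rewrite -addrA.
  have E2 : i + (q + (r - d)) + d = k by rewrite -addrA (degE _ _ _ e').
  rewrite /F -(sl_act hs_lin erefl E2) /=.
  rewrite -(rmulA erefl E1 erefl erefl); exact: hsM.
pose g1 := @GrHom A (extMod (freeMod A d)) X g0 g0D g0A.
exists g1; apply: grHom_ext => n.
apply: tens_ext => [t u|t u|i j e g a].
- by rewrite (hfunD (hcomp p g1)).
- by rewrite (hfunD f).
rewrite -[LHS]/(p n (g0 n (tpure e g a))) g0_pure p_hs.
have e3 : j - d + d = j by rewrite subrK.
(* Balancing moves etaR a back across the tensor sign, where it multiplies the generator to a. *)
by rewrite (balA (tpure_bal (freeMod A d) n) erefl _ e3 e) freeGen_span.
Qed.

End ProjectiveGenerator.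

(** * Acyclic comodules *)

Section Acyclic.
Variables (H : hopfAlgebroid) (V : rightAdjoint H).
Local Notation A := (uA H).
Implicit Types (K L M X Y Z : comod H).

Lemma Vmap_ccomp X Y Z (g : comodHom Y Z) (f : comodHom X Y) n x :
  Vmap V (ccomp g f) n x = Vmap V g n (Vmap V f n x).
Proof. by rewrite Vmap_comp. Qed.

(** The free module on a generator of degree n represents the degree n part, so by adjunction
    questions about elements of V become questions about comodule maps. *)
Lemma V_element M n (v : V M n) :
  exists f : comodHom (ext (freeMod A n)) M, Vadj V f n (freeGen A n) = v.
Proof.
have [h hv] := freeMod_hom_exists v; have [f fh] := Vadj_surj h.
by exists f; rewrite fh.
Qed.

Lemma V_element_inj M n (f g : comodHom (ext (freeMod A n)) M) :
  Vadj V f n (freeGen A n) = Vadj V g n (freeGen A n) -> f = g.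
Proof. by move/freeMod_hom_eq/Vadj_inj. Qed.

Lemma Vmap_element M M' (k : comodHom M M') n
    (f : comodHom (ext (freeMod A n)) M) :
  Vmap V k n (Vadj V f n (freeGen A n)) = Vadj V (ccomp k f) n (freeGen A n).
Proof. by rewrite Vadj_natr. Qed.

Lemma Vmap_hinj K L (i : comodHom K L) : hinj i -> hinj (Vmap V i).
Proof.
move=> ii n v w; have [f <-] := V_element v; have [g <-] := V_element w.
by rewrite !Vmap_element => /V_element_inj /(hinj_comod_mono ii) ->.
Qed.

Lemma Vmap_eq0 M M' (k : comodHom M M') n (f : comodHom (ext (freeMod A n)) M) :
  Vmap V k n (Vadj V f n (freeGen A n)) = 0 -> ccomp k f = czero _ M'.
Proof.
by rewrite Vmap_element => E; apply: V_element_inj; rewrite E Vadj_zero.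
Qed.

(** For the two projections of a biproduct, this makes equality in V testable componentwise. *)
Lemma Vmap_joint_hinj M M1 M2 (p : comodHom M M1) (q : comodHom M M2) :
  (forall n (x : M n), p n x = 0 -> q n x = 0 -> x = 0) ->
  forall n (v : V M n), Vmap V p n v = 0 -> Vmap V q n v = 0 -> v = 0.
Proof.
move=> pq n v; have [f <-] := V_element v => /Vmap_eq0 pf /Vmap_eq0 qf.
suff -> : f = czero _ M by rewrite Vadj_zero.
apply: comodHom_ext => m x; apply: pq.
- exact: (hfunE (congr1 (@chom H _ _) pf)).
- exact: (hfunE (congr1 (@chom H _ _) qf)).
Qed.

Lemma hexact_ccomp K L M (i : comodHom K L) (p : comodHom L M) :
  hexact i p -> ccomp p i = czero K M.
Proof. by move=> ip; apply: comodHom_ext => n x; apply/(ip n); exists x. Qed.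

Lemma hexact_V0 K L M (i : comodHom K L) (p : comodHom L M) n (v : V K n) :
  hexact i p -> Vmap V p n (Vmap V i n v) = 0.
Proof. by move=> ip; rewrite -Vmap_ccomp hexact_ccomp // Vmap_zero. Qed.

Hypothesis flat : Gamma_flat H.

(** A representing map killed by p factors through the kernel i. *)
Lemma Vmap_exact K L M (i : comodHom K L) (p : comodHom L M) :
  hinj i -> hexact i p -> hexact (Vmap V i) (Vmap V p).
Proof.
move=> ii ip n v; split=> [|[u <-]]; last exact: hexact_V0.
have [f <-] := V_element v => /Vmap_eq0 pf.
have [g <-] : exists g, ccomp i g = f.
  apply: (comod_hinj_lift flat ii) => m x.
  by apply/(ip m); apply: (hfunE (congr1 (@chom H _ _) pf)).
by exists (Vadj V g n (freeGen A n)); apply: Vmap_element.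
Qed.

(* Q is the first cosyzygy of X in its cobar resolution by extended comodules,
   so [acyclic k X] says that R^j_rel V(X) = 0 for 0 < j <= k. *)
Fixpoint acyclic (k : nat) (X : comod H) : Prop :=
  if k is k'.+1 then
    forall (Q : comod H) (q : comodHom (ext X) Q),
      hsurj q -> hexact (coactHom X) q -> hsurj (Vmap V q) /\ acyclic k' Q
  else True.

(** A comodule retraction r of the coaction splits the sequence from X through [ext X] to Q. Hence V
    q is a split surjection and Q, a summand of [ext X], is again relatively injective. *)
Lemma rel_injective_acyclic X : rel_injective X -> forall k, acyclic k X.
Proof.
move=> Xinj k; elim: k X Xinj => [//|k IHk] X Xinj Q q sq Xq.
have [r rX] := rel_injective_retract Xinj.
have rXE n x : r n (coact X n x) = x.
  exact: (hfunE (congr1 (@chom H _ _) rX)).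
(* The section s is induced by 1 - coact r, which kills the image of the coaction. *)
have [s sE] : exists s : comodHom Q (ext X),
    forall n x, s n (q n x) = x - coact X n (r n x).
  have [s0 s0E] : exists s0, hcomp s0 q =
      hadd (hid (ext X)) (hopp (hcomp (coact X) r)).
    apply: hsurj_lift => // n x /Xq[y <-].
    by rewrite -[LHS]/(coact X n y - coact X n (r n (coact X n y))) rXE subrr.
  have sE n x : s0 n (q n x) = x - coact X n (r n x) by exact: (hcompE s0E).
  suff sP : forall n (x : Q n),
      coact (ext X) n (s0 n x) = extMap s0 n (coact Q n x).
    by exists (ComodHom sP).
  move=> n x; have [y <-] := sq n x; rewrite chom_coact -extMap_comp s0E.
  rewrite extMap_add extMap_opp extMap_id -[s0 n _]/(s0 n (q n y)) sE hfunB.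
  rewrite extMap_comp -(chom_coact r); congr (_ - _).
  exact: (chom_coact (coactHom X)).
have qs : ccomp q s = Defs.cid Q.
  apply: comodHom_ext => n x; have [y <-] := sq n x.
  rewrite -[LHS]/(q n (s n (q n y))) sE hfunB.
  suff -> : q n (coact X n (r n y)) = 0 by rewrite subr0.
  by apply/(Xq n); exists (r n y).
split=> [n v|]; last exact/IHk/(retract_rel_injective qs)/rel_injective_ext.
by exists (Vmap V s n v); rewrite -Vmap_ccomp qs Vmap_id.
Qed.

Section ShortExact.
Variables (X Y Z : comod H) (i : comodHom X Y) (p : comodHom Y Z).
Hypotheses (ii : hinj i) (sp : hsurj p) (ip : hexact i p).
Variables (QX QY QZ : comod H).
Variables (qX : comodHom (ext X) QX) (qY : comodHom (ext Y) QY).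
Variable (qZ : comodHom (ext Z) QZ).
Hypotheses (sX : hsurj qX) (eX : hexact (coactHom X) qX).
Hypotheses (sY : hsurj qY) (eY : hexact (coactHom Y) qY).
Hypotheses (sZ : hsurj qZ) (eZ : hexact (coactHom Z) qZ).

(** The instance of the nine lemma that allows dimension shifting along the cobar resolution. *)
Lemma cobar_step_short_exact :
  exists (j : comodHom QX QY) (r : comodHom QY QZ),
    [/\ ccomp j qX = ccomp qY (extHom i), ccomp r qY = ccomp qZ (extHom p),
        hinj j, hsurj r & hexact j r].
Proof.
have nat (X' Y' : comod H) (f : comodHom X' Y') n x :
    extMap f n (coact X' n x) = coact Y' n (f n x) by rewrite chom_coact.
have [j jE] : exists j, ccomp j qX = ccomp qY (extHom i).
  apply: comod_hsurj_lift => // n x /eX[y <-].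
  by apply: (eY (extMap i n (coact X n y))).2; exists (i n y); rewrite nat.
have [r rE] : exists r, ccomp r qY = ccomp qZ (extHom p).
  apply: comod_hsurj_lift => // n x /eY[y <-].
  by apply: (eZ (extMap p n (coact Y n y))).2; exists (p n y); rewrite nat.
have jE' n x : j n (qX n x) = qY n (extMap i n x).
  exact: (hfunE (congr1 (@chom H _ _) jE)).
have rE' n x : r n (qY n x) = qZ n (extMap p n x).
  exact: (hfunE (congr1 (@chom H _ _) rE)).
have eip := extMap_exact (H := H) sp ip.
exists j, r; split=> //.
- move=> n x y E; apply/eqP; rewrite -subr_eq0; move/eqP: E.
  rewrite -subr_eq0 -hfunB; move: (x - y) => z {x y} /eqP.
  have [x <-] := sX z; rewrite jE' => /eY[y yE]; apply/eqP/eX.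
  rewrite -[coactHom Y n y]/(coact Y n y) in yE.
  (* Applying the counit to (Γ ⊗ i) x = coact y shows that y comes from X; then x is the coaction of
     that element, because Γ ⊗ i is injective. *)
  have iy : i n (counitHom X n x) = y.
    rewrite -counitHom_natural -yE; exact: coact_counit.
  exists (counitHom X n x); apply: (flat ii).
  by rewrite -[coactHom X n _]/(coact X n _) nat iy.
- move=> n z; have [x <-] := sZ z; have [y <-] := extMap_surj (H := H) sp x.
  by exists (qY n y); rewrite rE'.
move=> n y; split=> [|[x <-]]; last first.
  have [x' <-] := sX x; rewrite jE' rE'.
  suff -> : extMap p n (extMap i n x') = 0 by rewrite hfun0.
  by apply/eip; exists x'.
have [x <-] := sY y; rewrite rE' => /eZ[z zE].
(* Subtracting coact y' brings x into the kernel of Γ ⊗ p without changing its class in QY. *)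
have [y' y'z] := sp z.
have /eip[w wE] : extMap p n (x - coact Y n y') = 0.
  by rewrite hfunB nat y'z -zE subrr.
exists (qX n w); rewrite jE' wE hfunB.
suff -> : qY n (coact Y n y') = 0 by rewrite subr0.
by apply/eY; exists y'.
Qed.

End ShortExact.

Hypothesis proj : Gamma_projective H.

(** Under both adjunctions an element of V (ext N') is an A-linear map from the projective module Γ
    ⊗ A[n] to N', and it lifts along p. *)
Lemma Vmap_ext_surj (N N' : grMod A) (p : grHom N N') :
  hsurj p -> hsurj (Vmap V (extHom p)).
Proof.
move=> sp n v; have [f <-] := V_element v.
have [g pg] := extMod_freeMod_projective proj (hcomp (counitHom N') f) sp.
exists (Vadj V (colift (M := ext (freeMod A n)) g) n (freeGen A n)).
rewrite Vmap_element; congr (Vadj V _ n _); apply: ext_hom_eq.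
rewrite -pg; apply: grHom_ext => m x.
rewrite -[LHS]/(counitHom N' m
  (extMap p m (colift (M := ext (freeMod A n)) g m x))).
rewrite counitHom_natural; congr (p m _).
exact: (hfunE (coliftK (M := ext (freeMod A n)) g)).
Qed.

(** The image of z in V (ext Z) lifts to w in V (ext Y), whose class in V QY comes from some u in V
    QX. By acyclicity u lifts to v in V (ext X), and w corrected by v comes from the desired y in V
    Y. *)
Lemma acyclic_Vmap_surj X Y Z (i : comodHom X Y) (p : comodHom Y Z) :
  hinj i -> hsurj p -> hexact i p -> acyclic 1 X -> hsurj (Vmap V p).
Proof.
move=> ii sp ip aX n z.
have [QX [qX [sX eX]]] := cokernel_exists (coactHom X).
have [QY [qY [sY eY]]] := cokernel_exists (coactHom Y).
have [QZ [qZ [sZ eZ]]] := cokernel_exists (coactHom Z).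
have [j [r [jE rE ij sr jr]]] :=
  cobar_step_short_exact ii sp ip sX eX sY eY sZ eZ.
have coact_hinj M : hinj (coactHom M) by apply/rel_mono_hinj/coact_rel_mono.
have coactE M M' (f : comodHom M M') :
    ccomp (extHom f) (coactHom M) = ccomp (coactHom M') f.
  by apply: comodHom_ext => m x; apply/esym/chom_coact.
have [w wE] := Vmap_ext_surj sp (Vmap V (coactHom Z) n z).
have /(Vmap_exact ij jr)[u uE] : Vmap V r n (Vmap V qY n w) = 0.
  rewrite -Vmap_ccomp rE Vmap_ccomp wE; exact: hexact_V0.
have [v vE] := (aX QX qX sX eX).1 n u.
have /(Vmap_exact (@coact_hinj Y) eY)[y yE] :
    Vmap V qY n (w - Vmap V (extHom i) n v) = 0.
  by rewrite hfunB -[X in _ - X]Vmap_ccomp -jE Vmap_ccomp vE uE subrr.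
exists y; apply: (Vmap_hinj (@coact_hinj Z)).
rewrite -Vmap_ccomp -coactE Vmap_ccomp yE hfunB wE -[X in _ - X]Vmap_ccomp.
have -> : ccomp (extHom p) (extHom i) = czero (ext X) (ext Z).
  apply: hexact_ccomp; exact: extMap_exact.
by rewrite Vmap_zero subr0.
Qed.

(** Dimension shifting: the cosyzygies of X, Y and Z satisfy the same hypotheses. Each step uses up
    one degree of acyclicity of X and Y, hence the assumption in all degrees. *)
Lemma acyclic_quotient X Y Z (i : comodHom X Y) (p : comodHom Y Z) :
  hinj i -> hsurj p -> hexact i p ->
  (forall k, acyclic k X) -> (forall k, acyclic k Y) -> forall k, acyclic k Z.
Proof.
move=> + + + + + k; elim: k X Y Z i p => [//|k IHk] X Y Z i p ii sp ip aX aY.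
move=> QZ qZ sZ eZ.
have [QX [qX [sX eX]]] := cokernel_exists (coactHom X).
have [QY [qY [sY eY]]] := cokernel_exists (coactHom Y).
have [j [r [jE rE ij sr jr]]] :=
  cobar_step_short_exact ii sp ip sX eX sY eY sZ eZ.
have aQX m := (aX m.+1 QX qX sX eX).2; have aQY m := (aY m.+1 QY qY sY eY).2.
split; last exact: IHk ij sr jr aQX aQY.
(* An element of V QZ lifts to V QY because QX is acyclic, then to V (ext Y), and is pushed forward
   to V (ext Z). *)
move=> n z; have [y <-] := acyclic_Vmap_surj ij sr jr (aQX 1%N) z.
have [w <-] := (aY 1%N QY qY sY eY).1 n y; exists (Vmap V (extHom p) n w).
by rewrite -!Vmap_ccomp rE.
Qed.

(** The resolution is cut into short exact sequences from Z through C j to Z', with Z' the next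
    cocycles. Acyclicity passes from Z to Z', V keeps each sequence exact, and the results are
    spliced. *)
Lemma acyclic_resolution_exact X (C : resolution X) :
  (forall k, acyclic k X) -> (forall j k, acyclic k (C j)) ->
  forall j, hexact (Vmap V (rdif C j)) (Vmap V (rdif C j.+1)).
Proof.
move=> aX aC.
have step j Z (i : comodHom Z (C j)) :
    hinj i -> hexact i (rdif C j) -> (forall k, acyclic k Z) ->
    hexact (Vmap V (rdif C j)) (Vmap V (rdif C j.+1)) /\
    exists (Z' : comod H) (i' : comodHom Z' (C j.+1)),
      [/\ hinj i', hexact i' (rdif C j.+1) & forall k, acyclic k Z'].
  move=> ii ie aZ; have [Z' [p [sp ip]]] := cokernel_exists i.
  have [i' i'p] : exists i', ccomp i' p = rdif C j.
    by apply: comod_hsurj_lift => // n x /ip /ie.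
  have i'E n x : i' n (p n x) = rdif C j n x by rewrite -i'p.
  have ii' : hinj i'.
    move=> n x y E; apply/eqP; rewrite -subr_eq0; move/eqP: E.
    rewrite -subr_eq0 -hfunB; move: (x - y) => z /eqP.
    by have [w <-] := sp n z; rewrite i'E => /ie/ip ->.
  have ie' : hexact i' (rdif C j.+1).
    move=> n x; split=> [/rexact[y <-]|[y <-]].
      by exists (p n y).
    by have [z <-] := sp n y; rewrite i'E; apply/rexact; exists z.
  split; last first.
    by exists Z', i'; split=> //; apply: acyclic_quotient ip aZ (aC j).
  move=> n v; split=> [/(Vmap_exact ii' ie')[u <-]|[u <-]]; last first.
    apply: hexact_V0; apply: rexact.
  have [w <-] := acyclic_Vmap_surj ii sp ip (aZ 1%N) u.
  by exists w; rewrite -i'p Vmap_ccomp.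
move=> j; suff [Z [i [ii ie aZ]]] : exists (Z : comod H) (i : comodHom Z (C j)),
    [/\ hinj i, hexact i (rdif C j) & forall k, acyclic k Z].
  exact: (step _ _ _ ii ie aZ).1.
elim: j => [|j [Z [i [ii ie aZ]]]]; last exact: (step _ _ _ ii ie aZ).2.
by exists X, (raug C); split=> //; [apply: raug_inj | apply: rexact0].
Qed.

End Acyclic.

(** * Biproducts and mapping cones *)

Section Biproduct.
Variable H : hopfAlgebroid.
Local Notation A := (uA H).

Section Objects.
Variables X Y : comod H.

Definition prodMod : grMod A.
Proof.
exists (fun n => (X n * Y n)%type : zmodType)
  (fun i j k e a z => (act e a z.1, act e a z.2)).
- by move=> i j k e a b [x y] /=; rewrite !actDl.
- by move=> i j k e a [x y] [x' y'] /=; rewrite !actDr.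
- by move=> i j k ij jk n e1 e2 e3 e4 a b [x y] /=; rewrite !(actA e1 e2 e3 e4).
- by move=> i e [x y] /=; rewrite !act1.
Defined.

Definition prod_fst : grHom prodMod X.
Proof. by exists (fun n z => z.1). Defined.

Definition prod_snd : grHom prodMod Y.
Proof. by exists (fun n z => z.2). Defined.

Definition prod_pair (Z : grMod A) (f : grHom Z X) (g : grHom Z Y) :
  grHom Z prodMod.
Proof.
exists (fun n z => (f n z, g n z)) => [n x y|i j k e a x].
  by rewrite !hfunD.
by rewrite !hfun_act.
Defined.

Let inl := prod_pair (hid X) (hzero X Y).
Let inr := prod_pair (hzero Y X) (hid Y).

Let pair_add (Z : grMod A) (f : grHom Z X) (g : grHom Z Y) :
  prod_pair f g = hadd (hcomp inl f) (hcomp inr g).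
Proof.
apply: grHom_ext => n z; rewrite -[RHS]/(f n z + 0, 0 + g n z).
by rewrite addr0 add0r.
Qed.

(** As Γ ⊗ (X × Y) is not literally a product, the coaction is assembled from the injections. *)
Let prod_coact : grHom prodMod (extMod prodMod) :=
  hadd (hcomp (hcomp (extMap inl) (coact X)) prod_fst)
       (hcomp (hcomp (extMap inr) (coact Y)) prod_snd).

Let prod_coactE n (z : prodMod n) :
  prod_coact n z = extMap inl n (coact X n z.1) + extMap inr n (coact Y n z.2).
Proof. by []. Qed.

Let prod_coact_inl : hcomp prod_coact inl = hcomp (extMap inl) (coact X).
Proof.
apply: grHom_ext => n x; rewrite hcomp_app prod_coactE (hfun0 (coact Y)).
by rewrite (hfun0 (extMap inr)) addr0.
Qed.

Let prod_coact_inr : hcomp prod_coact inr = hcomp (extMap inr) (coact Y).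
Proof.
apply: grHom_ext => n x; rewrite hcomp_app prod_coactE (hfun0 (coact X)).
by rewrite (hfun0 (extMap inl)) add0r.
Qed.

Definition prodComod : comod H.
Proof.
exists prodMod prod_coact => n [x y]; rewrite prod_coactE.
  rewrite (hfunD (extMap prod_coact)) -!extMap_comp.
  rewrite prod_coact_inl prod_coact_inr.
  rewrite cofreeD 2!extMap_comp !coact_coassoc; congr (_ + _); apply/esym.
    exact: (chom_coact (extHom inl)).
  exact: (chom_coact (extHom inr)).
rewrite counit_actD.
rewrite -[X in X + _]/(counitHom _ n _) -[X in _ + X]/(counitHom _ n _).
rewrite !counitHom_natural -[x in RHS]addr0 -[y in RHS]add0r.
by congr (inl n _ + inr n _); apply: coact_counit.
Defined.

Definition cfst : comodHom prodComod X.
Proof.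
exists prod_fst => n z; rewrite prod_coactE (hfunD (extMap prod_fst)).
by rewrite -!extMap_comp extMap_eqid // extMap_eq0 // addr0.
Defined.

Definition csnd : comodHom prodComod Y.
Proof.
exists prod_snd => n z; rewrite prod_coactE (hfunD (extMap prod_snd)).
by rewrite -!extMap_comp extMap_eq0 // extMap_eqid // add0r.
Defined.

Definition cpair (Z : comod H) (f : comodHom Z X) (g : comodHom Z Y) :
  comodHom Z prodComod.
Proof.
exists (prod_pair f g) => n z; rewrite prod_coactE [in RHS]pair_add extMap_add.
by rewrite !extMap_comp -!chom_coact.
Defined.

Lemma rel_injective_prod :
  rel_injective X -> rel_injective Y -> rel_injective prodComod.
Proof.
move=> Xinj Yinj K L i im f.
have [g gE] := Xinj _ _ _ im (ccomp cfst f).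
have [h hE] := Yinj _ _ _ im (ccomp csnd f).
exists (cpair g h); apply: comodHom_ext => n x.
rewrite -[LHS]/(ccomp g i n x, ccomp h i n x) gE hE.
exact/esym/surjective_pairing.
Qed.

End Objects.

Definition csub (X Y : comod H) (f g : comodHom X Y) : comodHom X Y.
Proof.
exists (hadd f (hopp g)) => n x; rewrite extMap_add extMap_opp -!chom_coact.
exact: hfunB.
Defined.

Section Additivity.
Variable V : rightAdjoint H.

Lemma Vmap_eq (X Y : comod H) (f g : comodHom X Y) n (v : V X n) :
  (forall m x, f m x = g m x) -> Vmap V f n v = Vmap V g n v.
Proof. by move=> fg; rewrite (comodHom_ext fg). Qed.

(** The inverse of the canonical map from V (X × Y) to V X × V Y. *)
Definition Vpair (X Y : comod H) n (a : V X n) (b : V Y n) :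
    V (prodComod X Y) n :=
  Vmap V (cpair (Defs.cid X) (czero X Y)) n a +
  Vmap V (cpair (czero Y X) (Defs.cid Y)) n b.

Lemma Vmap_fst_pair (X Y : comod H) n (a : V X n) (b : V Y n) :
  Vmap V (cfst X Y) n (Vpair a b) = a.
Proof.
rewrite hfunD -!Vmap_ccomp.
rewrite (_ : ccomp _ _ = Defs.cid X); last exact: comodHom_ext.
rewrite (_ : ccomp _ _ = czero Y X); last exact: comodHom_ext.
by rewrite Vmap_id Vmap_zero addr0.
Qed.

Lemma Vmap_snd_pair (X Y : comod H) n (a : V X n) (b : V Y n) :
  Vmap V (csnd X Y) n (Vpair a b) = b.
Proof.
rewrite hfunD -!Vmap_ccomp.
rewrite (_ : ccomp _ _ = czero X Y); last exact: comodHom_ext.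
rewrite (_ : ccomp _ _ = Defs.cid Y); last exact: comodHom_ext.
by rewrite Vmap_id Vmap_zero add0r.
Qed.

Lemma Vprod_eq (X Y : comod H) n (v w : V (prodComod X Y) n) :
  Vmap V (cfst X Y) n v = Vmap V (cfst X Y) n w ->
  Vmap V (csnd X Y) n v = Vmap V (csnd X Y) n w -> v = w.
Proof.
move=> E1 E2; apply/eqP; rewrite -subr_eq0; apply/eqP.
apply: (@Vmap_joint_hinj H V (prodComod X Y) X Y (cfst X Y) (csnd X Y)).
- by move=> m [x y] /= -> ->.
- by rewrite hfunB E1 subrr.
- by rewrite hfunB E2 subrr.
Qed.

(** Additivity of V follows from its compatibility with biproducts: a difference of maps is their
    pairing followed by the difference of the projections. *)
Lemma Vmap_csub (X Y : comod H) (f g : comodHom X Y) n (v : V X n) :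
  Vmap V (csub f g) n v = Vmap V f n v - Vmap V g n v.
Proof.
pose neg := csub (czero Y Y) (Defs.cid Y).
have subE (Z : comod H) (h k : comodHom Z Y) m (u : V Z m) :
    Vmap V (csub h k) m u = Vmap V h m u + Vmap V neg m (Vmap V k m u).
  have -> : csub h k = ccomp (csub (cfst Y Y) (csnd Y Y)) (cpair h k).
    exact: comodHom_ext.
  rewrite Vmap_ccomp.
  have -> : Vmap V (cpair h k) m u = Vpair (Vmap V h m u) (Vmap V k m u).
    apply: Vprod_eq; rewrite ?Vmap_fst_pair ?Vmap_snd_pair -Vmap_ccomp;
    exact: Vmap_eq.
  rewrite hfunD -!Vmap_ccomp; congr (_ + _); apply: Vmap_eq => l x.
    exact: subr0.
  by [].
rewrite subE; congr (_ + _); move: (Vmap V g n v) => u.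
(* The case of two identity maps shows that V neg is negation. *)
have := subE Y (Defs.cid Y) (Defs.cid Y) n u.
rewrite Vmap_id -[hid _ n u]/u (_ : csub _ _ = czero Y Y); last first.
  by apply: comodHom_ext => m x; rewrite -[LHS]/(x - x) subrr.
by rewrite Vmap_zero => /esym/eqP; rewrite addrC addr_eq0 => /eqP.
Qed.

End Additivity.
End Biproduct.

(** * Comparison of resolutions and the mapping cone *)

Section Comparison.
Variables (H : hopfAlgebroid) (M : comod H).
Implicit Types (K L X Y Z : comod H).

Hypothesis flat : Gamma_flat H.

(** Modulo the kernel of g, the map g becomes injective and h remains defined, so injectivity of E
    applies to the coimage. *)
Lemma comod_injective_extend E Y Z (g : comodHom Y Z) (h : comodHom Y E) :
  comod_injective E -> (forall n y, g n y = 0 -> h n y = 0) ->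
  exists h' : comodHom Z E, ccomp h' g = h.
Proof.
move=> Einj gh; have [X [f [_ fg]]] := kernel_exists flat g.
have [C [q [sq fq]]] := cokernel_exists f.
have [g' g'E] : exists g', ccomp g' q = g.
  by apply: comod_hsurj_lift => // n y /fq /fg.
have [k kE] : exists k, ccomp k q = h.
  by apply: comod_hsurj_lift => // n y /fq /fg /gh.
have ig' : hinj g'.
  move=> n x y E'; apply/eqP; rewrite -subr_eq0; move/eqP: E'.
  rewrite -subr_eq0 -hfunB; move: (x - y) => z /eqP.
  have [w <-] := sq n z; rewrite -[g' n _]/(ccomp g' q n w) g'E.
  by move=> /fg /fq ->.
have [h' h'E] := Einj _ _ _ (hinj_comod_mono ig') k.
exists h'; rewrite -kE -h'E -g'E; exact: comodHom_ext.
Qed.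

Lemma resolution_dd (J : resolution M) k n (x : J k n) :
  rdif J k.+1 n (rdif J k n x) = 0.
Proof. by apply/rexact; exists x. Qed.

Lemma resolution_daug (J : resolution M) n (x : M n) :
  rdif J 0 n (raug J n x) = 0.
Proof. by apply/rexact0; exists x. Qed.

Lemma comparison (I J : resolution M) :
  injective_resolution I ->
  exists f : forall k, comodHom (J k) (I k),
    (forall n x, f 0%N n (raug J n x) = raug I n x) /\
    forall k n x, f k.+1 n (rdif J k n x) = rdif I k n (f k n x).
Proof.
move=> Iinj.
(* Preserving cocycles is what lets the next map exist, so it is carried along the recursion. *)
pose good k (f : comodHom (J k) (I k)) :=
  forall n x, rdif J k n x = 0 -> rdif I k n (f n x) = 0.
have [f0 f0E] : exists f0, ccomp f0 (raug J) = raug I.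
  exact/Iinj/hinj_comod_mono/raug_inj.
have {}f0E n x : f0 n (raug J n x) = raug I n x by rewrite -f0E.
have f0good : good 0%N f0.
  by move=> n x /rexact0[y <-]; rewrite f0E resolution_daug.
have next k (s : {f | good k f}) : {s' : {f | good k.+1 f} |
    forall n x, sval s' n (rdif J k n x) = rdif I k n (sval s n x)}.
  case: s => f fgood; apply: boolp.cid.
  have [f' f'E] := comod_injective_extend (h := ccomp (rdif I k) f)
    (@Iinj k.+1) fgood.
  have {}f'E n x : f' n (rdif J k n x) = rdif I k n (f n x).
    exact: (hfunE (congr1 (@chom H _ _) f'E)).
  suff f'good : good k.+1 f' by exists (exist _ f' f'good).
  by move=> n x /rexact[y <-]; rewrite f'E resolution_dd.
pose fs := fix fs k : {f | good k f} :=
  if k is k'.+1 then sval (next k' (fs k')) else exist _ f0 f0good.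
exists (fun k => sval (fs k)); split=> // k n x.
exact: (svalP (next k (fs k))).
Qed.

Section Cone.
Variables (I J : resolution M) (f : forall k, comodHom (J k) (I k)).
Hypothesis f_aug : forall n x, f 0%N n (raug J n x) = raug I n x.
Hypothesis f_dif :
  forall k n x, f k.+1 n (rdif J k n x) = rdif I k n (f k n x).

(** The minus sign on the I part makes consecutive maps compose to zero. *)
Definition cone_dif k : comodHom (prodComod (J k.+1) (I k))
    (prodComod (J k.+2) (I k.+1)) :=
  cpair (ccomp (rdif J k.+1) (cfst _ _))
    (csub (ccomp (f k.+1) (cfst _ _)) (ccomp (rdif I k) (csnd _ _))).

Lemma cone_exact0 : hexact (cpair (rdif J 0) (f 0%N)) (cone_dif 0).
Proof.
move=> n [x y]; split=> [[/rexact[z <-]]|[z [<- <-]]]; last first.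
  congr pair; first exact: resolution_dd.
  rewrite -[LHS]/(f 1%N n (rdif J 0 n z) - rdif I 0 n (f 0%N n z)).
  by rewrite f_dif subrr.
move=> E; have /rexact0[m mE] : rdif I 0 n (f 0%N n z - y) = 0.
  by rewrite hfunB -f_dif.
(* Subtracting the augmentation of m changes f z into y and leaves d z alone. *)
exists (z - raug J n m).
rewrite -[LHS]/(rdif J 0 n _, f 0%N n _).
rewrite !hfunB resolution_daug subr0 f_aug mE; congr pair.
by rewrite opprB addrC subrK.
Qed.

Lemma cone_exact k : hexact (cone_dif k) (cone_dif k.+1).
Proof.
move=> n [x y]; split=> [[/rexact[z <-]]|[[z w] [<- <-]]]; last first.
  congr pair; first exact: resolution_dd.
  rewrite -[LHS]/(f k.+2 n (rdif J k.+1 n z) -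
    rdif I k.+1 n (f k.+1 n z - rdif I k n w)).
  by rewrite f_dif hfunB resolution_dd subr0 subrr.
move=> E; have /rexact[w wE] : rdif I k.+1 n (f k.+1 n z - y) = 0.
  by rewrite hfunB -f_dif.
exists (z, w).
rewrite -[LHS]/(rdif J k.+1 n z, f k.+1 n z - rdif I k n w).
by rewrite wE opprB addrC subrK.
Qed.

Lemma cone_aug_hinj : hinj (cpair (rdif J 0) (f 0%N)).
Proof.
move=> n x y [dE fE]; apply/eqP; rewrite -subr_eq0.
have /rexact0[z zE] : rdif J 0 n (x - y) = 0 by rewrite hfunB dE subrr.
rewrite -zE (_ : z = 0) ?hfun0 //; apply: (@raug_inj _ _ I n).
by rewrite -f_aug zE hfunB fE subrr hfun0.
Qed.

(* The mapping cone of f, as an exact continuation of its first object J 0. *)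
Definition cone : resolution (J 0%N) :=
  Resolution cone_aug_hinj cone_exact0 cone_exact.

End Cone.

End Comparison.

(** * Isomorphism of the derived functors, and the theorem *)

Section Main.
Variable H : hopfAlgebroid.

(** The hypotheses provide in turn a map on cocycles, well-definedness and injectivity of the
    induced map, and its surjectivity. *)
Lemma subquot_grIso (A : grRing) (Y Y' : grMod A) (Z B : grSub Y)
    (Z' B' : grSub Y') (f : grHom Y Y') :
  (forall n x, Z n x -> Z' n (f n x)) ->
  (forall n x, Z n x -> B n x <-> B' n (f n x)) ->
  (forall n y, Z' n y -> exists2 x, Z n x & B' n (y - f n x)) ->
  grIso (subquot Z B) (subquot Z' B').
Proof.
move=> fZ fB fsurj.
have ZB n x x' : Z n x -> Z n x' -> Z n (x - x') by apply: smemB.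
pose R n (u : subquot Z B n) (w : subquot Z' B' n) :=
  exists x (Zx : Z n x) (Zfx : Z' n (f n x)),
    u = sqclass B Zx /\ w = sqclass B' Zfx.
have [] := @hom_of_relation _ _ _ R.
- move=> n u; have [x [Zx ->]] := sqclassP u.
  by exists (sqclass B' (fZ n x Zx)), x, Zx, (fZ n x Zx).
- move=> n u w w' [x [Zx [Zfx [-> ->]]]] [x' [Zx' [Zfx' [+ ->]]]].
  move=> /sqclass_eq /fB E; apply/sqclass_eq; rewrite -hfunB.
  by apply: E; apply: ZB.
- move=> n u u' w w' [x [Zx [Zfx [-> ->]]]] [x' [Zx' [Zfx' [-> ->]]]].
  have Zxx : Z n (x + x') by apply: smemD.
  have Zfxx := fZ n _ Zxx; exists (x + x'), Zxx, Zfxx.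
  split; first exact/esym/sqclassD.
  rewrite -(sqclassD _ Zfx Zfx' (smemD Zfx Zfx')); apply/sqclass_eq.
  by rewrite hfunD subrr; apply: smem0.
- move=> i j k e a u w [x [Zx [Zfx [-> ->]]]].
  have Zax := smem_act e a Zx; have Zfax := fZ k _ Zax.
  exists (act e a x), Zax, Zfax; split; first exact/esym/sqclass_act.
  rewrite -(sqclass_act _ Zfx (smem_act e a Zfx)); apply/sqclass_eq.
  by rewrite hfun_act subrr; apply: smem0.
move=> g gR; apply: (@bijective_grIso _ _ _ g) => n.
  move=> u u'; have [x [Zx [Zfx [-> ->]]]] := gR n u.
  have [x' [Zx' [Zfx' [-> ->]]]] := gR n u' => /sqclass_eq E.
  by apply/sqclass_eq/fB; [apply: ZB | rewrite hfunB].
move=> w; have [y [Zy ->]] := sqclassP w; have [x Zx Bx] := fsurj n y Zy.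
exists (sqclass B Zx).
(* [gR] yields some representative x' of the class, which may differ from x by an element of B. *)
have [x' [Zx' [Zfx' [/sqclass_eq E ->]]]] := gR n (sqclass B Zx).
apply/sqclass_eq.
have -> : f n x' - y = 0 - (y - f n x) - f n (x - x').
  by rewrite hfunB sub0r !opprB [RHS]addrC subrKA.
apply: smemB; first by apply: smemB Bx; apply: smem0.
by apply/(fB n); first exact: ZB.
Qed.

Variable V : rightAdjoint H.
Hypotheses (flat : Gamma_flat H) (proj : Gamma_projective H).

Lemma derivedV_grIso (M : comod H) (I J : resolution M) :
  injective_resolution I -> (forall k, rel_injective (J k)) ->
  forall n, grIso (derivedV V J n) (derivedV V I n).
Proof.
move=> Iinj Jinj k; have [f [f_aug f_dif]] := comparison flat J Iinj.
pose C := cone f_aug f_dif.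
have Cinj j : rel_injective (C j).
  exact/rel_injective_prod/comod_injective_rel/Iinj/Jinj.
have C_exact := acyclic_resolution_exact flat proj
  (rel_injective_acyclic V (Jinj 0%N))
  (fun j => rel_injective_acyclic V (Cinj j)).
have C_exact0 : hexact (Vmap V (raug C)) (Vmap V (rdif C 0)).
  exact: (Vmap_exact flat (@raug_inj _ _ C) (@rexact0 _ _ C)).
have C_inj : hinj (Vmap V (raug C)) := Vmap_hinj (@raug_inj _ _ C).
have augE n (u : V (J 0%N) n) :
    (Vmap V (cfst _ _) n (Vmap V (raug C) n u) = Vmap V (rdif J 0) n u) *
    (Vmap V (csnd _ _) n (Vmap V (raug C) n u) = Vmap V (f 0%N) n u).
  by rewrite -!Vmap_ccomp; split; apply: Vmap_eq.
have difE j n (w : V (C j) n) :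
    (Vmap V (cfst _ _) n (Vmap V (rdif C j) n w) =
     Vmap V (rdif J j.+1) n (Vmap V (cfst _ _) n w)) *
    (Vmap V (csnd _ _) n (Vmap V (rdif C j) n w) =
     Vmap V (f j.+1) n (Vmap V (cfst _ _) n w) -
     Vmap V (rdif I j) n (Vmap V (csnd _ _) n w)).
  by rewrite -!Vmap_ccomp -Vmap_csub; split; apply: Vmap_eq.
(* Exactness of V on the cone is applied to such pairs: (x, b) for injectivity on cohomology, (0, y)
   for surjectivity. *)
have cocycle j n a b : Vmap V (rdif J j.+1) n a = 0 ->
    Vmap V (f j.+1) n a = Vmap V (rdif I j) n b ->
    Vmap V (rdif C j) n (Vpair a b) = 0.
  move=> a0 ab; apply: Vprod_eq;
    rewrite difE Vmap_fst_pair ?Vmap_snd_pair hfun0 //.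
  by rewrite ab subrr.
have Vf_dif j n u : Vmap V (f j.+1) n (Vmap V (rdif J j) n u) =
    Vmap V (rdif I j) n (Vmap V (f j) n u).
  by rewrite -!Vmap_ccomp; apply: Vmap_eq => m x; apply: f_dif.
apply: (@subquot_grIso _ _ _ _ _ _ _ (Vmap V (f k)))
  => /= [n x x0|n x x0|n y y0].
- by rewrite -Vf_dif x0 hfun0.
(* In degree 0 the coboundaries vanish, and V is injective on the augmentation of the cone. Above, f
   x = d b makes (x, b) a cocycle of the cone, hence a boundary, so x = d u. Degree 1 is separate
   because there the boundaries come from J 0. *)
- case: k x x0 => [|k] x x0 /=.
    split=> [->|fx0]; first exact: hfun0.
    apply: C_inj; rewrite hfun0; apply: Vprod_eq; rewrite augE hfun0 //.
  split=> [[u <-]|[b bE]]; first by exists (Vmap V (f k) n u); rewrite Vf_dif.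
  have {bE} := cocycle k n x b x0 (esym bE).
  case: k x b x0 => [|k] x b x0.
    by move=> /C_exact0[u uE]; exists u; rewrite -augE uE Vmap_fst_pair.
  move=> /C_exact[u uE]; exists (Vmap V (cfst _ _) n u).
  by rewrite -difE uE Vmap_fst_pair.
(* The cocycle (0, y) of the cone is the image of some u, whose J component is a cocycle that f
   sends to y up to a boundary. *)
have := cocycle k n 0 y; rewrite !hfun0 y0 => /(_ erefl erefl).
case: k y y0 => [|k] y y0 => [/C_exact0|/C_exact] [u uE].
  exists u; first by rewrite -augE uE Vmap_fst_pair.
  by rewrite -augE uE Vmap_snd_pair subrr.
exists (Vmap V (cfst _ _) n u); first by rewrite -difE uE Vmap_fst_pair.
exists (- Vmap V (csnd _ _) n u); rewrite raddfN /=.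
have := (difE k n u).2; rewrite uE Vmap_snd_pair => ->.
by rewrite addrAC subrr add0r.
Qed.

End Main.

Theorem proposition3p5 (H : hopfAlgebroid) (V : rightAdjoint H) (M : comod H) :
  Gamma_flat H ->
  [/\ (* (1) *)
      (rel_cotorsion M -> cotorsion M) /\
      (is_field (uA H) -> cotorsion M -> rel_cotorsion M),
      (* (2) *)
      (gr_is_zero (V M) <-> rel_cotorsion M) /\
      (rel_cotorsion M <-> forall n (x : M n), smem (Itr M) x -> x = 0%R)
    & (* (3) *)
      Gamma_projective H ->
      forall I J : resolution M,
        injective_resolution I -> rel_injective_resolution J ->
        forall n : nat, grIso (derivedV V I n) (derivedV V J n)].
Proof.
move=> flat; split.
- split=> [Mcot J /comod_injective_rel Jinj|fA Mcot J Jinj]; first exact: Mcot.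
  exact/Mcot/(field_rel_injective flat fA).
- split; [exact: V_is_zero_rel_cotorsion | exact: Itr_is_zero_rel_cotorsion].
move=> proj I J Iinj [Jinj _] n; apply: grIso_sym.
exact: derivedV_grIso.
Qed.
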